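(* Let $R$ be a ring, $M$ an $R$-$R$-bimodule, $R\ltimes M$ the trivial ring extension, $n\geqslant 1$ an integer, and $\mathcal{C},\mathcal{D}$ classes of left $R$-modules. (1) Let $(\mathcal{C},\mathcal{D})$ be a hereditary left $n$-cotorsion pair in $R$-$\mathrm{Mod}$. Assume that $\mathrm{Ext}_R^i(M,D)=0$ and $\mathrm{Ext}_R^1(\mathrm{Hom}_R(M,F),F)=0$ for each $1\leqslant i\leqslant n$, any $D\in\mathcal{D}$ and any $F\in\mathcal{D}_{n-1}^{\wedge}$, and that $(\mathfrak{J}^{\mathcal{D}})_{n-1}^{\wedge}$ is closed under extensions. Then $(\mathfrak{U}^{\mathcal{C}},\mathfrak{J}^{\mathcal{D}})$ is a hereditary left $n$-cotorsion pair in $R\ltimes M$-$\mathrm{Mod}$. (2) Let $(\mathcal{C},\mathcal{D})$ be a hereditary right $n$-cotorsion pair in $R$-$\mathrm{Mod}$. Assume that $\mathrm{Tor}_i^R(M,C)=0$ and $\mathrm{Ext}_R^1(E,M\otimes_R E)=0$ for each $1\leqslant i\leqslant n$, any $C\in\mathcal{C}$ and any $E\in\mathcal{C}_{n-1}^{\vee}$, and that $(\mathfrak{B}^{\mathcal{C}})_{n-1}^{\vee}$ is closed under extensions. Then $(\mathfrak{B}^{\mathcal{C}},\mathfrak{U}^{\mathcal{D}})$ is a hereditary right $n$-cotorsion pair in $R\ltimes M$-$\mathrm{Mod}$.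
   Context: Rings are associative with identity, modules are unitary, and $S$-$\mathrm{Mod}$ is the category of left $S$-modules. Classes of modules contain $0$ and are closed under isomorphisms. The trivial ring extension $R\ltimes M$ is $R\times M$ with componentwise addition and $(r_1,m_1)(r_2,m_2)=(r_1r_2,r_1m_2+m_1r_2)$. A left $R\ltimes M$-module is identified with a pair $(X,\alpha)$, where $X$ is a left $R$-module and $\alpha:M\otimes_R X\to X$ is $R$-linear with $\alpha\circ(M\otimes_R\alpha)=0$; equivalently (by adjunction) with a pair $[Y,\beta]$, where $Y$ is a left $R$-module and $\beta:Y\to\mathrm{Hom}_R(M,Y)$ is $R$-linear with $\mathrm{Hom}_R(M,\beta)\circ\beta=0$. Morphisms are $R$-linear maps compatible with the structure maps; a sequence is exact iff the underlying sequence of $R$-modules is exact. For a class $\mathcal{C}$ of left $R$-modules: $\mathfrak{U}^{\mathcal{C}}$ is the class of $R\ltimes M$-modules $(X,\alpha)$ with $X\in\mathcal{C}$ (equivalently $[Y,\beta]$ with $Y\in\mathcal{C}$); $\mathfrak{B}^{\mathcal{C}}$ is the class of $(X,\alpha)$ with $\mathrm{Coker}\,\alpha\in\mathcal{C}$ and $M\otimes_R M\otimes_R X\xrightarrow{M\otimes_R\alpha}M\otimes_R X\xrightarrow{\alpha}X$ exact; $\mathfrak{J}^{\mathcal{C}}$ is the class of $[Y,\beta]$ with $\mathrm{Ker}\,\beta\in\mathcal{C}$ and $Y\xrightarrow{\beta}\mathrm{Hom}_R(M,Y)\xrightarrow{\mathrm{Hom}_R(M,\beta)}\mathrm{Hom}_R(M,\mathrm{Hom}_R(M,Y))$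 exact. For a class $\mathcal{C}$ of objects of an abelian category and $m\geqslant 0$: $\mathcal{C}_m^{\wedge}$ is the class of objects $A$ admitting an exact sequence $0\to C_k\to\cdots\to C_0\to A\to 0$ with all $C_i\in\mathcal{C}$ and some $k\leqslant m$; $\mathcal{C}_m^{\vee}$ is the class of objects $A$ admitting an exact sequence $0\to A\to C^0\to\cdots\to C^k\to 0$ with all $C^i\in\mathcal{C}$ and some $k\leqslant m$. A pair $(\mathcal{C},\mathcal{D})$ of classes of objects in an abelian category is a left $n$-cotorsion pair if (i) $\mathcal{C}$ is closed under direct summands, (ii) $\mathrm{Ext}^i(C,D)=0$ for all $1\leqslant i\leqslant n$, $C\in\mathcal{C}$, $D\in\mathcal{D}$, and (iii) every object $A$ admits a short exact sequence $0\to K\to C\to A\to 0$ with $C\in\mathcal{C}$, $K\in\mathcal{D}_{n-1}^{\wedge}$. It is a right $n$-cotorsion pair if (i') $\mathcal{D}$ is closed under direct summands, (ii) holds, and (iii') every object $A$ admits a short exact sequence $0\to A\to D\to K\to 0$ with $D\in\mathcal{D}$, $K\in\mathcal{C}_{n-1}^{\vee}$. A left or right $n$-cotorsion pair $(\mathcal{C},\mathcal{D})$ is hereditary if $\mathrm{Ext}^{n+1}(C,D)=0$ for all $C\in\mathcal{C}$, $D\in\mathcal{D}$. *)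

(* Defs.v *)
From HB Require Import structures.
From mathcomp Require Import all_boot all_algebra.
From mathcomp Require Import boolp.
From mathcomp Require Import freeg.

Set Implicit Arguments.
Unset Strict Implicit.
Unset Printing Implicit Defensive.

Import GRing.Theory.
Local Open Scope ring_scope.
Local Open Scope quotient_scope.

(* Rings are [pzRingType] rather than [nzRingType], so that the zero ring is
   allowed, and left modules are [lmodType]. *)

(** * Exactness, kernels and cokernels *)

Section Exactness.
Variable R : pzRingType.
Implicit Types U V W : lmodType R.

Definition surj (A B : Type) (f : A -> B) := forall b, exists a, f a = b.

Definition exact_at U V W (f : {linear U -> V}) (g : {linear V -> W}) :=
  forall v, g v = 0 <-> exists u, f u = v.

Definition short_exact U V W (f : {linear U -> V}) (g : {linear V -> W}) :=
  [/\ injective f, exact_at f g & surj g].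

Definition isomorphic U V := exists f : {linear U -> V}, bijective f.

Definition zero_module U := forall u : U, u = 0.

End Exactness.

Section Kernel.
Variables (R : pzRingType) (U V : lmodType R) (f : {linear U -> V}).

Definition in_ker : {pred U} := fun u => f u == 0.

Lemma in_ker_submod : submod_closed in_ker.
Proof.
split=> [|a u v]; rewrite /in_ker !unfold_in /= ?linear0 // linearP.
by move=> /eqP-> /eqP->; rewrite scaler0 addr0.
Qed.
HB.instance Definition _ := GRing.isSubmodClosed.Build R U in_ker in_ker_submod.

Record ker := Ker { ker_val :> U; _ : in_ker ker_val }.
HB.instance Definition _ := [isSub for ker_val].
HB.instance Definition _ := [Choice of ker by <:].
HB.instance Definition _ := [SubChoice_isSubZmodule of ker by <:].
HB.instance Definition _ := [SubZmodule_isSubLmodule of ker by <:].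

End Kernel.

Section Cokernel.
Variables (R : pzRingType) (U V : lmodType R) (f : {linear U -> V}).

Definition in_im : {pred V} := fun v => `[< exists u, f u = v >].

Lemma in_im_zmod : zmod_closed in_im.
Proof.
split=> [|_ _ /asboolP[u <-] /asboolP[v <-]]; apply/asboolP.
  by exists 0; rewrite linear0.
by exists (u - v); rewrite linearB.
Qed.
HB.instance Definition _ := GRing.isZmodClosed.Build V in_im in_im_zmod.

Definition coker := {ideal_quot in_im}.
HB.instance Definition _ := GRing.Zmodule.on coker.
Definition coker_pi (v : V) : coker := \pi_{ideal_quot in_im} v.

Lemma coker_piE v w : (coker_pi v = coker_pi w) <-> (exists u, f u = v - w).
Proof.
rewrite /coker_pi; split=> [/eqP|h].
  by rewrite -Quotient.idealrBE => /asboolP.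
by apply/eqP; rewrite -Quotient.idealrBE; apply/asboolP.
Qed.

Lemma coker_piB v w : coker_pi (v - w) = coker_pi v - coker_pi w.
Proof. by rewrite /coker_pi !raddfB. Qed.
Lemma coker_piD v w : coker_pi (v + w) = coker_pi v + coker_pi w.
Proof. by rewrite /coker_pi !raddfD. Qed.

Definition coker_scale (a : R) (c : coker) : coker := coker_pi (a *: repr c).

Lemma coker_scaleE a v : coker_scale a (coker_pi v) = coker_pi (a *: v).
Proof.
have /coker_piE[u fu] : coker_pi (repr (coker_pi v)) = coker_pi v.
  exact: reprK.
by apply/coker_piE; exists (a *: u); rewrite linearZ /= fu scalerBr.
Qed.

Lemma coker_ind (P : coker -> Prop) : (forall v, P (coker_pi v)) -> forall c, P c.
Proof. by move=> h c; rewrite -[c]reprK. Qed.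

Fact coker_scaleA a b c :
  coker_scale a (coker_scale b c) = coker_scale (a * b) c.
Proof. by elim/coker_ind: c => v; rewrite !coker_scaleE scalerA. Qed.
Fact coker_scale1 : left_id 1 coker_scale.
Proof. by elim/coker_ind=> v; rewrite coker_scaleE scale1r. Qed.
Fact coker_scaleDr : right_distributive coker_scale +%R.
Proof.
move=> a; elim/coker_ind=> v; elim/coker_ind=> w.
by rewrite -coker_piD !coker_scaleE scalerDr coker_piD.
Qed.
Fact coker_scaleDl c : {morph coker_scale^~ c : a b / a + b}.
Proof.
by elim/coker_ind: c => v a b; rewrite !coker_scaleE scalerDl coker_piD.
Qed.
HB.instance Definition _ := GRing.Zmodule_isLmodule.Build R coker
  coker_scaleA coker_scale1 coker_scaleDr coker_scaleDl.

End Cokernel.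

(** * Bimodules *)

HB.mixin Record Lmodule_isBimodule (R : pzRingType) M of GRing.Lmodule R M := {
  rscale : M -> R -> M;
  rscaleA : forall m a b, rscale (rscale m a) b = rscale m (a * b);
  rscale1 : forall m, rscale m 1 = m;
  rscaleDl : forall m n a, rscale (m + n) a = rscale m a + rscale n a;
  rscaleDr : forall m a b, rscale m (a + b) = rscale m a + rscale m b;
  rscaleZ : forall a m b, rscale (a *: m) b = a *: rscale m b;
}.
#[short(type="bimodType")]
HB.structure Definition Bimodule (R : pzRingType) :=
  {M of GRing.Lmodule R M & Lmodule_isBimodule R M}.

Section BimoduleTheory.
Variables (R : pzRingType) (M : bimodType R).

Lemma rscale0l a : rscale (0 : M) a = 0.
Proof. by apply: (addrI (rscale 0 a)); rewrite -rscaleDl !addr0. Qed.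
Lemma rscale0r (m : M) : rscale m (0 : R) = 0.
Proof. by apply: (addrI (rscale m 0)); rewrite -rscaleDr !addr0. Qed.

End BimoduleTheory.

(** * The left module Hom_R(M, Y), with (a f)(m) = f(m a) *)

Section LinearMaps.
Variables (R : pzRingType) (U V : lmodType R).

Definition mk_linear_fun (f : U -> V) (fP : linear f) := f.
HB.instance Definition _ f fP :=
  GRing.isLinear.Build R U V *:%R (@mk_linear_fun f fP) fP.
Definition mk_linear f fP : {linear U -> V} := @mk_linear_fun f fP.

Lemma linear_ext (f g : {linear U -> V}) : f =1 g -> f = g.
Proof.
move=> /funext; case: f g => [f [[a1] [b1]]] [g [[a2] [b2]]] /= efg.
by subst g; rewrite (Prop_irrelevance a1 a2) (Prop_irrelevance b1 b2).
Qed.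

End LinearMaps.

Section HomModule.
Variables (R : pzRingType) (M : bimodType R) (Y : lmodType R).

Definition homM := {linear M -> Y}.
HB.instance Definition _ := gen_eqMixin homM.
HB.instance Definition _ := gen_choiceMixin homM.
Implicit Types f g h : homM.

Fact homM_zero_linear : linear (fun _ : M => 0 : Y).
Proof. by move=> a m n; rewrite scaler0 addr0. Qed.
Fact homM_opp_linear f : linear (fun m => - f m).
Proof. by move=> a m n; rewrite linearP opprD scalerN. Qed.
Fact homM_add_linear f g : linear (fun m => f m + g m).
Proof. by move=> a m n; rewrite !linearP scalerDr addrACA. Qed.
Fact homM_scale_linear a f : linear (fun m => f (rscale m a)).
Proof. by move=> b m n; rewrite rscaleDl rscaleZ linearP. Qed.

Definition homM_zero : homM := mk_linear homM_zero_linear.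
Definition homM_opp f : homM := mk_linear (homM_opp_linear f).
Definition homM_add f g : homM := mk_linear (homM_add_linear f g).
Definition homM_scale a f : homM := mk_linear (homM_scale_linear a f).

Fact homM_addA : associative homM_add.
Proof. by move=> f g h; apply: linear_ext => m; exact: addrA. Qed.
Fact homM_addC : commutative homM_add.
Proof. by move=> f g; apply: linear_ext => m; exact: addrC. Qed.
Fact homM_add0 : left_id homM_zero homM_add.
Proof. by move=> f; apply: linear_ext => m; exact: add0r. Qed.
Fact homM_addN : left_inverse homM_zero homM_opp homM_add.
Proof. by move=> f; apply: linear_ext => m; exact: addNr. Qed.
HB.instance Definition _ := GRing.isZmodule.Build homM
  homM_addA homM_addC homM_add0 homM_addN.

Fact homM_scaleA a b f : homM_scale a (homM_scale b f) = homM_scale (a * b) f.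
Proof. by apply: linear_ext => m; congr (f _); exact: rscaleA. Qed.
Fact homM_scale1 : left_id 1 homM_scale.
Proof. by move=> f; apply: linear_ext => m; congr (f _); exact: rscale1. Qed.
Fact homM_scaleDr : right_distributive homM_scale +%R.
Proof. by move=> a f g; exact: linear_ext. Qed.
Fact homM_scaleDl f : {morph homM_scale^~ f : a b / a + b}.
Proof.
move=> a b; apply: linear_ext => m.
rewrite -[LHS]/(f (rscale m (a + b))) rscaleDr; exact: linearD.
Qed.
HB.instance Definition _ := GRing.Zmodule_isLmodule.Build R homM
  homM_scaleA homM_scale1 homM_scaleDr homM_scaleDl.

Lemma homM_DE f g m : (f + g : homM) m = f m + g m. Proof. by []. Qed.
Lemma homM_ZE a f m : (a *: f : homM) m = f (rscale m a). Proof. by []. Qed.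

End HomModule.

Section HomFunctor.
Variables (R : pzRingType) (M : bimodType R) (Y Z : lmodType R).
Variable f : {linear Y -> Z}.

Fact homM_comp_linear (u : homM M Y) : linear (fun m => f (u m)).
Proof. by move=> a m n; rewrite !linearP. Qed.
Fact homM_map_linear :
  linear (fun u : homM M Y => mk_linear (homM_comp_linear u) : homM M Z).
Proof. by move=> a u v; apply: linear_ext => m; exact: linearD. Qed.
Definition homM_map : {linear homM M Y -> homM M Z} := mk_linear homM_map_linear.

End HomFunctor.

(** * The left module M (x)_R X, as a quotient of the free abelian group on M * X *)

Section Tensor.
Variables (R : pzRingType) (M : bimodType R) (X : lmodType R).

Definition formal_tens (m : M) (x : X) : {freeg (M * X) / int} := << (m, x) >>.

Inductive tensor_relator : {freeg (M * X) / int} -> Prop :=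
| relDl m n x : tensor_relator
    (formal_tens (m + n) x - formal_tens m x - formal_tens n x)
| relDr m x y : tensor_relator
    (formal_tens m (x + y) - formal_tens m x - formal_tens m y)
| relZ m a x : tensor_relator
    (formal_tens (rscale m a) x - formal_tens m (a *: x)).

(* membership in the subgroup generated by the relators *)
Definition tensor_rel : {pred {freeg (M * X) / int}} := fun t =>
  `[< forall S : zmodClosed {freeg (M * X) / int},
        (forall u, tensor_relator u -> u \in S) -> t \in S >].

Lemma tensor_rel_zmod : zmod_closed tensor_rel.
Proof.
split=> [|u v /asboolP hu /asboolP hv]; apply/asboolP => S hS.
  exact: rpred0.
by rewrite rpredB ?hu ?hv.
Qed.
HB.instance Definition _ := GRing.isZmodClosed.Build _ tensor_rel tensor_rel_zmod.

Definition tensor := {ideal_quot tensor_rel}.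
HB.instance Definition _ := GRing.Zmodule.on tensor.

Definition tens (m : M) (x : X) : tensor :=
  \pi_{ideal_quot tensor_rel} (formal_tens m x).

Lemma tensor_pi_eq0 u :
  tensor_relator u -> \pi_{ideal_quot tensor_rel} u = 0 :> tensor.
Proof.
move=> hu; rewrite -[0 : tensor](raddf0 (\pi_{ideal_quot tensor_rel})).
apply/eqP; rewrite -Quotient.idealrBE subr0; apply/asboolP => S; exact.
Qed.

Lemma tensDl m n x : tens (m + n) x = tens m x + tens n x.
Proof.
apply/eqP; rewrite -subr_eq0 opprD addrA -!raddfB.
by apply/eqP/tensor_pi_eq0; exact: relDl.
Qed.
Lemma tensDr m x y : tens m (x + y) = tens m x + tens m y.
Proof.
apply/eqP; rewrite -subr_eq0 opprD addrA -!raddfB.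
by apply/eqP/tensor_pi_eq0; exact: relDr.
Qed.
Lemma tensZ m a x : tens (rscale m a) x = tens m (a *: x).
Proof.
apply/eqP; rewrite -subr_eq0 -!raddfB.
by apply/eqP/tensor_pi_eq0; exact: relZ.
Qed.

Lemma tensor_ind (P : tensor -> Prop) : P 0 ->
  (forall s t, P s -> P t -> P (s - t)) -> (forall m x, P (tens m x)) ->
  forall t, P t.
Proof.
move=> P0 PB Pt t; rewrite -[t]reprK -[repr t]freeg_sumE raddf_sum.
have PN s : P s -> P (- s) by move=> Ps; rewrite -sub0r; exact: PB.
have PD s s' : P s -> P s' -> P (s + s').
  by move=> Ps Ps'; rewrite -[s']opprK; apply/PB/PN.
elim/big_ind: _ => // -[m x] _; move: (coeff _ _) => k.
rewrite -[k]intz -freegU_mulz raddfMz.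
have Pn n : P (tens m x *+ n).
  by elim: n => [|n IH]; rewrite ?mulr0n // mulrS; exact: PD.
by case: k => n; rewrite ?NegzE ?mulrNz; [exact: Pn | exact/PN/Pn].
Qed.

Lemma tensor_ext (V : zmodType) (f g : {additive tensor -> V}) :
  (forall m x, f (tens m x) = g (tens m x)) -> f =1 g.
Proof.
move=> h; elim/tensor_ind=> [|s t fs ft|//]; first by rewrite !raddf0.
by rewrite !raddfB fs ft.
Qed.

(* The universal property: a balanced map [phi] extends to an additive map. *)
Section Lift.
Variables (V : zmodType) (phi : M -> X -> V).

Definition balanced :=
  [/\ forall m n x, phi (m + n) x = phi m x + phi n x,
      forall m x y, phi m (x + y) = phi m x + phi m y &
      forall m a x, phi (rscale m a) x = phi m (a *: x)].

Hypothesis phiP : balanced.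

Let pre (u : {freeg (M * X) / int}) : zmodule V :=
  fglift (fun p => phi p.1 p.2 : zmodule V) u.
Definition tensor_lift (t : tensor) : V := pre (repr t).

Let pre_formal m x : pre (formal_tens m x) = phi m x.
Proof. by rewrite /pre liftU scale1r. Qed.
Let preB u v : pre (u - v) = pre u - pre v.
Proof. exact: lift_is_additive. Qed.
Let pre0 : pre 0 = 0.
Proof. by rewrite -(subrr 0) preB subrr. Qed.

Let pre_rel u : u \in tensor_rel -> pre u = 0.
Proof.
pose S : {pred {freeg (M * X) / int}} := fun u => pre u == 0.
have Szmod : zmod_closed S.
  split=> [|v w]; rewrite /S !unfold_in; first by rewrite pre0.
  by move=> /eqP hv /eqP hw; rewrite preB hv hw subr0.
pose SM := GRing.isZmodClosed.Build _ S Szmod.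
pose SC : zmodClosed _ := HB.pack S SM.
move=> /asboolP/(_ SC) hu; apply/eqP/hu => v; rewrite unfold_in /S /=.
by have [hl hr hb] := phiP; case=> [m n x|m x y|m a x]; apply/eqP;
   rewrite !preB !pre_formal ?hl ?hr ?hb ?subrr // addrAC addrK subrr.
Qed.

Lemma tensor_liftB : {morph tensor_lift : s t / s - t}.
Proof.
move=> s t; apply/eqP; rewrite -subr_eq0 /tensor_lift -!preB.
apply/eqP/pre_rel; rewrite Quotient.idealrBE reprK raddfB /= !reprK //.
Qed.

Lemma tensor_liftE m x : tensor_lift (tens m x) = phi m x.
Proof.
apply/eqP; rewrite -subr_eq0 /tensor_lift -pre_formal -preB.
by apply/eqP/pre_rel; rewrite Quotient.idealrBE reprK.
Qed.

End Lift.

Section LiftAdditive.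
Variables (V : zmodType) (phi : M -> X -> V) (phiP : balanced phi).

Definition tensor_lift_fun := let _ := phiP in tensor_lift phi.
HB.instance Definition _ :=
  GRing.isZmodMorphism.Build tensor V tensor_lift_fun (tensor_liftB phiP).
Definition tensor_lift_add : {additive tensor -> V} := tensor_lift_fun.

Lemma tensor_lift_addE m x : tensor_lift_add (tens m x) = phi m x.
Proof. exact: tensor_liftE. Qed.

End LiftAdditive.
End Tensor.

Section TensorModule.
Variables (R : pzRingType) (M : bimodType R) (X : lmodType R).
Notation T := (tensor M X).

Fact tensor_scale_balanced (a : R) :
  balanced (fun (m : M) (x : X) => tens (a *: m) x).
Proof.
split=> [m n x|m x y|m b x]; first by rewrite scalerDr tensDl.
  by rewrite tensDr.
by rewrite -rscaleZ tensZ.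
Qed.
Definition tensor_scale (a : R) : T -> T :=
  tensor_lift_add (tensor_scale_balanced a).

Lemma tensor_scaleE a m x : tensor_scale a (tens m x) = tens (a *: m) x.
Proof. exact: tensor_lift_addE. Qed.

Fact tensor_scaleDr : right_distributive tensor_scale +%R.
Proof. by move=> a s t; rewrite /tensor_scale raddfD. Qed.
Fact tensor_scaleBr a s t :
  tensor_scale a (s - t) = tensor_scale a s - tensor_scale a t.
Proof. by rewrite /tensor_scale raddfB. Qed.
Fact tensor_scale0r a : tensor_scale a 0 = 0.
Proof. by rewrite /tensor_scale raddf0. Qed.
Fact tensor_scaleA a b t :
  tensor_scale a (tensor_scale b t) = tensor_scale (a * b) t.
Proof.
elim/tensor_ind: t => [|s t hs ht|m x]; first by rewrite !tensor_scale0r.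
  by rewrite !tensor_scaleBr hs ht.
by rewrite !tensor_scaleE scalerA.
Qed.
Fact tensor_scale1 : left_id 1 tensor_scale.
Proof.
elim/tensor_ind=> [|s t hs ht|m x]; first by rewrite tensor_scale0r.
  by rewrite tensor_scaleBr hs ht.
by rewrite tensor_scaleE scale1r.
Qed.
Fact tensor_scaleDl t : {morph tensor_scale^~ t : a b / a + b}.
Proof.
move=> a b; elim/tensor_ind: t => [|s t hs ht|m x].
- by rewrite !tensor_scale0r addr0.
- by rewrite !tensor_scaleBr hs ht opprD addrACA.
by rewrite !tensor_scaleE scalerDl tensDl.
Qed.
HB.instance Definition _ := GRing.Zmodule_isLmodule.Build R T
  tensor_scaleA tensor_scale1 tensor_scaleDr tensor_scaleDl.

Lemma tensZl a m x : a *: tens m x = tens (a *: m) x :> T.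
Proof. exact: tensor_scaleE. Qed.

Section LiftLinear.
Variables (V : lmodType R) (phi : M -> X -> V) (phiP : balanced phi).
Hypothesis phiZ : forall a m x, phi (a *: m) x = a *: phi m x.

Fact tensor_lift_linear : linear (tensor_lift_add phiP).
Proof.
move=> a s t; rewrite raddfD; congr (_ + _).
elim/tensor_ind: s => [|s s' hs hs'|m x]; first by rewrite scaler0 raddf0 scaler0.
  by rewrite scalerBr !raddfB hs hs'.
by rewrite tensZl !tensor_lift_addE phiZ.
Qed.
Definition tensor_lift_lin : {linear T -> V} := mk_linear tensor_lift_linear.

Lemma tensor_lift_linE m x : tensor_lift_lin (tens m x) = phi m x.
Proof. exact: tensor_lift_addE. Qed.

End LiftLinear.
End TensorModule.

Section TensorFunctor.
Variables (R : pzRingType) (M : bimodType R) (X Y : lmodType R).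
Variable f : {linear X -> Y}.

Fact tensor_map_balanced : balanced (fun (m : M) x => tens m (f x)).
Proof.
split=> [m n x|m x y|m a x]; first exact: tensDl.
  by rewrite linearD tensDr.
by rewrite linearZ tensZ.
Qed.
Fact tensor_map_scale a (m : M) x : tens (a *: m) (f x) = a *: tens m (f x).
Proof. by rewrite tensZl. Qed.
Definition tensor_map : {linear tensor M X -> tensor M Y} :=
  tensor_lift_lin tensor_map_balanced tensor_map_scale.

Lemma tensor_mapE m x : tensor_map (tens m x) = tens m (f x).
Proof. exact: tensor_lift_linE. Qed.

End TensorFunctor.
Arguments tensor_map {R} M {X Y} f.
Arguments homM_map {R} M {Y Z} f.

(** * The trivial ring extension of R by M *)

Definition trivext (R : pzRingType) (M : bimodType R) : Type := (R * M)%type.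

Section TrivialExtension.
Variables (R : pzRingType) (M : bimodType R).
Notation S := (trivext M).

HB.instance Definition _ := GRing.Zmodule.copy S (R * M)%type.

Definition trivext_one : S := (1, 0).
Definition trivext_mul (s t : S) : S :=
  (s.1 * t.1, s.1 *: t.2 + rscale s.2 t.1).

Fact trivext_mulA : associative trivext_mul.
Proof.
move=> [a m] [b n] [c p]; rewrite /trivext_mul /=; congr pair.
  exact: mulrA.
by rewrite scalerDr scalerA rscaleDl rscaleZ rscaleA addrA.
Qed.
Fact trivext_mul1 : left_id trivext_one trivext_mul.
Proof.
by move=> [a m]; rewrite /trivext_mul /= mul1r scale1r rscale0l addr0.
Qed.
Fact trivext_mulr1 : right_id trivext_one trivext_mul.
Proof.
by move=> [a m]; rewrite /trivext_mul /= mulr1 scaler0 rscale1 add0r.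
Qed.
Fact trivext_mulDl : left_distributive trivext_mul +%R.
Proof.
move=> [a m] [b n] [c p]; rewrite /trivext_mul /=; congr pair.
  exact: mulrDl.
by rewrite scalerDl rscaleDl addrACA.
Qed.
Fact trivext_mulDr : right_distributive trivext_mul +%R.
Proof.
move=> [a m] [b n] [c p]; rewrite /trivext_mul /=; congr pair.
  exact: mulrDr.
by rewrite scalerDr rscaleDr addrACA.
Qed.
HB.instance Definition _ := GRing.Zmodule_isPzRing.Build S
  trivext_mulA trivext_mul1 trivext_mulr1 trivext_mulDl trivext_mulDr.

Lemma trivext_ME (s t : S) : s * t = (s.1 * t.1, s.1 *: t.2 + rscale s.2 t.1).
Proof. by []. Qed.
Lemma trivext_DE (s t : S) : s + t = (s.1 + t.1, s.2 + t.2).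
Proof. by []. Qed.

End TrivialExtension.

(** * Modules over the trivial extension *)

(* A left module X over [trivext M] determines the pairs (X, alpha) and
   [X, beta] of the usual descriptions: the underlying left R-module
   [restr X] is the restriction of scalars of X along a |-> (a, 0), and both
   alpha (m (x) x) and beta x m are the action (0, m) x of (0, m) on x. *)
Definition restr (R : pzRingType) (M : bimodType R)
  (X : lmodType (trivext M)) : Type := X.

Section Restriction.
Variables (R : pzRingType) (M : bimodType R) (X : lmodType (trivext M)).
Notation S := (trivext M).
Notation Y := (restr X).

HB.instance Definition _ := GRing.Zmodule.copy Y X.

Definition restr_scale (a : R) (x : Y) : Y := ((a, 0) : S) *: (x : X).

Fact restr_scaleA a b x : restr_scale a (restr_scale b x) = restr_scale (a * b) x.
Proof.
by rewrite /restr_scale scalerA trivext_ME /= scaler0 rscale0l addr0.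
Qed.
Fact restr_scale1 : left_id 1 restr_scale.
Proof. by move=> x; exact: (scale1r (x : X)). Qed.
Fact restr_scaleDr : right_distributive restr_scale +%R.
Proof. by move=> a x y; exact: (scalerDr _ (x : X)). Qed.
Fact restr_scaleDl x : {morph restr_scale^~ x : a b / a + b}.
Proof.
by move=> a b; rewrite /restr_scale -scalerDl trivext_DE /= addr0.
Qed.
HB.instance Definition _ := GRing.Zmodule_isLmodule.Build R Y
  restr_scaleA restr_scale1 restr_scaleDr restr_scaleDl.

Definition mact (m : M) (x : Y) : Y := ((0, m) : S) *: (x : X).

Lemma mactDl m n x : mact (m + n) x = mact m x + mact n x.
Proof. by rewrite /mact -[RHS]scalerDl trivext_DE /= addr0. Qed.
Lemma mactDr m x y : mact m (x + y) = mact m x + mact m y.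
Proof. exact: (scalerDr _ (x : X)). Qed.
Lemma mact_rscale m a x : mact (rscale m a) x = mact m (a *: x).
Proof.
rewrite /mact -[RHS]/(((0, m) : S) *: (((a, 0) : S) *: (x : X))).
by rewrite scalerA trivext_ME /= mul0r scaler0 add0r.
Qed.
Lemma mactZ a m x : mact (a *: m) x = a *: mact m x.
Proof.
rewrite /mact -[RHS]/(((a, 0) : S) *: (((0, m) : S) *: (x : X))).
by rewrite scalerA trivext_ME /= mulr0 rscale0l addr0.
Qed.

Fact mact_balanced : balanced mact.
Proof. split; [exact: mactDl | exact: mactDr | exact: mact_rscale]. Qed.
Definition alpha : {linear tensor M Y -> Y} := tensor_lift_lin mact_balanced mactZ.

Lemma alphaE m x : alpha (tens m x) = mact m x.
Proof. exact: tensor_lift_linE. Qed.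

Fact mact_linear x : linear (mact^~ x).
Proof. by move=> a m n; rewrite mactDl mactZ. Qed.
Fact beta_linear : linear (fun x : Y => mk_linear (mact_linear x) : homM M Y).
Proof.
move=> a x y; apply: linear_ext => m.
by rewrite -[LHS]/(mact m (a *: x + y)) mactDr -mact_rscale.
Qed.
Definition beta : {linear Y -> homM M Y} := mk_linear beta_linear.

Lemma betaE x m : beta x m = mact m x. Proof. by []. Qed.

End Restriction.
Arguments alpha {R M} X.
Arguments beta {R M} X.

(** * Classes of modules *)

Definition modclass (R : pzRingType) := lmodType R -> Prop.

(* The standing conventions on classes: they contain the zero modules and are
   closed under isomorphisms. *)
Definition is_class (R : pzRingType) (C : modclass R) :=
  (forall X, zero_module X -> C X) /\
  (forall X Y, isomorphic X Y -> C X -> C Y).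

Section TrivextClasses.
Variables (R : pzRingType) (M : bimodType R) (C : modclass R).

Definition classU : modclass (trivext M) := fun X => C (restr X).

Definition classB : modclass (trivext M) := fun X =>
  C (coker (alpha X)) /\ exact_at (tensor_map M (alpha X)) (alpha X).

Definition classJ : modclass (trivext M) := fun Y =>
  C (ker (beta Y)) /\ exact_at (beta Y) (homM_map M (beta Y)).

End TrivextClasses.
Arguments classU {R} M C.
Arguments classB {R} M C.
Arguments classJ {R} M C.

(** * Resolutions, Ext and Tor *)

(* exact ... -> X_1 -> X_0 -> A -> 0 *)
Record resolution (R : pzRingType) (A : lmodType R) := Resolution {
  res_obj :> nat -> lmodType R;
  res_d : forall i, {linear res_obj i.+1 -> res_obj i};
  res_aug : {linear res_obj 0 -> A};
  res_aug_surj : surj res_aug;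
  res_exact0 : exact_at (res_d 0) res_aug;
  res_exactS : forall i, exact_at (res_d i.+1) (res_d i);
}.

(* exact 0 -> A -> X^0 -> X^1 -> ... *)
Record coresolution (R : pzRingType) (A : lmodType R) := Coresolution {
  cores_obj :> nat -> lmodType R;
  cores_d : forall i, {linear cores_obj i -> cores_obj i.+1};
  cores_aug : {linear A -> cores_obj 0};
  cores_aug_inj : injective cores_aug;
  cores_exact0 : exact_at cores_aug (cores_d 0);
  cores_exactS : forall i, exact_at (cores_d i) (cores_d i.+1);
}.

Section FiniteResolutions.
Variables (R : pzRingType) (C : modclass R) (m : nat).

(* [wedge C m] and [vee C m] are the classes written C_m^/\ and C_m^\/. *)
Definition wedge : modclass R := fun A =>
  exists2 k, (k <= m)%N & exists X : resolution A,
    (forall i, (i <= k)%N -> C (X i)) /\ (forall i, (k < i)%N -> zero_module (X i)).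

Definition vee : modclass R := fun A =>
  exists2 k, (k <= m)%N & exists X : coresolution A,
    (forall i, (i <= k)%N -> C (X i)) /\ (forall i, (k < i)%N -> zero_module (X i)).

End FiniteResolutions.

Definition projective (R : pzRingType) (P : lmodType R) :=
  forall (U V : lmodType R) (f : {linear U -> V}) (g : {linear P -> V}),
    surj f -> exists h : {linear P -> U}, forall x, f (h x) = g x.

Section FreeCover.
Variables (R : nzRingType) (A : lmodType R).

Lemma fglift_linear (K : choiceType) (V : lmodType R) (f : K -> V) :
  linear (fglift f : {freeg K / R} -> V).
Proof.
have B := lift_is_additive f.
have f0 : fglift f 0 = 0 by rewrite -(subrr 0) B subrr.
have D x y : fglift f (x + y) = fglift f x + fglift f y.
  by rewrite -[x in RHS](addrK y) B subrK.
move=> a x y; rewrite D; congr (_ + _).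
rewrite -[x]freeg_sumE scaler_sumr.
elim/big_rec2: _ => [|z u v _ h]; first by rewrite f0 scaler0.
rewrite !D h scalerDr; congr (_ + _).
have -> : a *: << coeff z x *g z >> = << (a * coeff z x) *g z >> :> {freeg K / R}.
  by apply/eqP/freeg_eqP => t; rewrite coeffZ !coeffU mulrA.
by rewrite !liftU scalerA.
Qed.

Lemma free_cover : exists (P : lmodType R) (p : {linear P -> A}), projective P /\ surj p.
Proof.
exists {freeg A / R}, (mk_linear (fglift_linear (fun a => a))); split; last first.
  by move=> a; exists << a >>; rewrite /= /mk_linear_fun /= liftU scale1r.
move=> U V f g fs.
have [h hP] := choice fs.
exists (mk_linear (fglift_linear (fun a => h (g << a >>)))) => x.
rewrite -[x]freeg_sumE !linear_sum; apply: eq_bigr => z _.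
have -> : << coeff z x *g z >> = coeff z x *: << z >> :> {freeg A / R}.
  by apply/eqP/freeg_eqP => t; rewrite coeffZ !coeffU mulrA mulr1.
rewrite !linearZ /=; congr (_ *: _).
by rewrite /mk_linear_fun liftU scale1r hP.
Qed.

End FreeCover.

(* [freeg] needs a nonzero coefficient ring *)
Lemma enough_projectives (R : pzRingType) (A : lmodType R) :
  exists (P : lmodType R) (p : {linear P -> A}), projective P /\ surj p.
Proof.
have [e|ne] := eqVneq (1 : R) 0.
  exists A, (idfun : {linear A -> A}).
  have z (V : lmodType R) (x y : V) : x = y.
    by rewrite -[x]scale1r -[y]scale1r e !scale0r.
  split; last by move=> a; exists a; apply: z.
  move=> U V f g _.
  by exists (\0 : {linear A -> U}) => x; apply: z.
case: R A ne => T [c1 c2 c3 c4 c5 c6 c7 c8 c9 c10] A ne.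
pose c : GRing.PzRing.axioms_ T := @GRing.PzRing.Class T c1 c2 c3 c4 c5 c6 c7 c8 c9 c10.
pose Rp := GRing.PzRing.Pack c.
pose m := GRing.PzSemiRing_isNonZero.Build Rp ne.
pose Rn : nzRingType := HB.pack T c m.
exact: (@free_cover Rn A).
Qed.

Lemma projective_resolution_exists (R : pzRingType) (A : lmodType R) :
  exists P : resolution A, forall j, projective (P j).
Proof.
have cov (B : lmodType R) : {P : lmodType R & {p : {linear P -> B} | projective P /\ surj p}}.
  have /cid[P /cid[p hp]] := enough_projectives B.
  by exists P, p.
pose kerM (B : lmodType R) : lmodType R := ker (projT1 (projT2 (cov B))).
pose K := fix K n : lmodType R := if n is k.+1 then kerM (K k) else A.
pose P n := projT1 (cov (K n)).
pose p n : {linear P n -> K n} := projT1 (projT2 (cov (K n))).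
have pP n : projective (P n) /\ surj (p n) := proj2_sig (projT2 (cov (K n))).
have iL n : linear (fun x : K n.+1 => ker_val x : P n) by [].
pose i n : {linear K n.+1 -> P n} := mk_linear (iL n).
have dL n : linear (fun x => i n (p n.+1 x)) by move=> a x y; rewrite !linearP.
have ex n v : p n v = 0 <-> exists u, mk_linear (dL n) u = v.
  split=> [pv|[u <-]]; last first.
    by have /eqP := valP (p n.+1 u : ker _).
  have pv' : in_ker (p n) v by apply/eqP.
  have [u pu] := (pP n.+1).2 (Ker pv' : K n.+1).
  by exists u; rewrite /mk_linear /= /mk_linear_fun pu.
have i_inj n : injective (i n) by move=> x y; exact: (@val_inj _ _ (ker (p n))).
have exS n : exact_at (mk_linear (dL n.+1)) (mk_linear (dL n)).
  move=> v; rewrite -ex; split=> [|h].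
    by move=> h; apply: (i_inj n); rewrite (linear0 (i n)); exact: h.
  by rewrite -[LHS]/(i n (p n.+1 v)) h (linear0 (i n)).
exists (@Resolution R A P (fun n => mk_linear (dL n)) (p 0) (pP 0).2 (ex 0) exS).
by move=> j; case: (pP j).
Qed.

Section Derived.
Variable R : pzRingType.

(* Ext^i(A, B) = 0: the i-th cohomology of Hom_R(P, B) vanishes for the
   projective resolutions P of A.  By the comparison theorem this does not
   depend on P, and [projective_resolution_exists] gives such a P. *)
Definition Ext_vanishes (i : nat) (A B : lmodType R) :=
  forall P : resolution A, (forall j, projective (P j)) ->
  match i with
  | 0 => forall f : {linear P 0 -> B},
      (forall x, f (res_d P 0 x) = 0) -> forall x, f x = 0
  | j.+1 => forall f : {linear P j.+1 -> B},
      (forall x, f (res_d P j.+1 x) = 0) ->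
      exists g : {linear P j -> B}, forall x, f x = g (res_d P j x)
  end.

(* Tor_i(M, A) = 0: likewise with the homology of M (x)_R P. *)
Definition Tor_vanishes (i : nat) (M : bimodType R) (A : lmodType R) :=
  forall P : resolution A, (forall j, projective (P j)) ->
  match i with
  | 0 => surj (tensor_map M (res_d P 0))
  | j.+1 => exact_at (tensor_map M (res_d P j.+1)) (tensor_map M (res_d P j))
  end.

End Derived.

(** * n-cotorsion pairs *)

Section Cotorsion.
Variable R : pzRingType.
Implicit Types C D : modclass R.

(* For classes that are closed under isomorphisms, as in [is_class]. *)
Definition closed_under_summands C :=
  forall X Y : lmodType R, C (X * Y)%type -> C X.

Definition closed_under_extensions C :=
  forall (X Y Z : lmodType R) (f : {linear X -> Y}) (g : {linear Y -> Z}),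
    short_exact f g -> C X -> C Z -> C Y.

Definition left_cotorsion_pair (n : nat) C D :=
  [/\ is_class C, is_class D,
      closed_under_summands C,
      forall i X Y, (1 <= i <= n)%N -> C X -> D Y -> Ext_vanishes i X Y &
      forall A : lmodType R, exists (K X : lmodType R)
        (f : {linear K -> X}) (g : {linear X -> A}),
        [/\ short_exact f g, C X & wedge D n.-1 K]].

Definition right_cotorsion_pair (n : nat) C D :=
  [/\ is_class C, is_class D,
      closed_under_summands D,
      forall i X Y, (1 <= i <= n)%N -> C X -> D Y -> Ext_vanishes i X Y &
      forall A : lmodType R, exists (X K : lmodType R)
        (f : {linear A -> X}) (g : {linear X -> K}),
        [/\ short_exact f g, D X & vee C n.-1 K]].

Definition hereditary (n : nat) C D :=
  forall X Y, C X -> D Y -> Ext_vanishes n.+1 X Y.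

End Cotorsion.

(* Main.v *)
Require Import Defs.
From HB Require Import structures.
From mathcomp Require Import all_boot all_algebra.
From mathcomp Require Import boolp.
From mathcomp Require Import (canonicals) functions.

Set Implicit Arguments.
Unset Strict Implicit.
Unset Printing Implicit Defensive.

Import GRing.Theory.
Local Open Scope ring_scope.

(** Write S for the trivial extension of R by M. The idea is to identify the
    two new classes: under the hypotheses, the modules of [classJ M D] are the
    coinduced modules Hom_R(S, N), and those of [classB M C] the induced modules
    S (x)_R N, with N in D, respectively in C. The two statements are dual to
    each other; here is the first.

    A module Y in [classJ M D] is, over R, an extension of Hom_R(M, N) by the
    submodule N that M kills. The extension splits because
    Ext^1(Hom_R(M, N), N) = 0, and a retraction Y -> N induces an isomorphism
    of Y with Hom_R(S, N) ([coinduced_on_coind]).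

    Orthogonality: S-linear maps from X to Hom_R(S, N) are R-linear maps from X
    to N. A projective S-module P is a direct summand of a direct sum of copies
    of S, hence Ext_R^i(P, N) = 0 for 1 <= i <= n as Ext_R^i(M, N) = 0.
    Dimension shifting along a projective cover over S then carries the
    vanishing of Ext_R^i(X, N) for 1 <= i <= n+1 over to Ext_S^i(X, Hom_R(S, N))
    ([acyclic_coind]); in the dual statement Tor plays this role
    ([acyclic_ind]).

    Approximation: given an S-module A, take K -> X0 -> A over R with X0 in C
    and K finitely resolved by D. As Ext_R^1(M, K) = 0, the sequence
    Hom_R(S, K) -> Hom_R(S, X0) -> Hom_R(S, A) is short exact; its pullback
    along the unit A -> Hom_R(S, A) is an approximation E -> A with kernel
    Hom_R(S, K). Over R, the module E is an extension of X0 by Hom_R(M, K), so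
    it remains to see that Hom_R(M, K) lies in C ([homM_wedge]): then E does
    too, since C is the class of modules orthogonal to D
    ([left_cotorsion_orthogonal]).

    That Hom_R(M, K) lies in C uses the closure of the finitely resolved
    S-modules under extensions. Coinduction turns finite D-resolutions into
    finite resolutions by [classJ M D]; conversely, in an S-module so resolved
    the submodule killed by M is finitely D-resolved ([wedge_len_classJ]).
    Hence for finitely D-resolved F and F' the direct sum F * F' is again
    finitely D-resolved, and the hypothesis on Ext^1 applied to F * F' gives
    Ext^1(Hom_R(M, F), F') = 0 ([Ext_homM_wedge]). In particular the
    approximation of Hom_R(M, K) given by the cotorsion pair splits.

    Dimension shifting in the first variable is formally the same for Ext and
    for Tor, and is carried out once for both ([pushout_stable], [acyclic]). *)

(** * Linear maps, pullbacks and short exact sequences *)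

Section LinearMaps.
Variable R : pzRingType.
Implicit Types A B C K L P Q U V W X Y KA KB KC PA PB PC : lmodType R.

Lemma linear_inj U V (f : {linear U -> V}) :
  (forall u, f u = 0 -> u = 0) -> injective f.
Proof.
move=> f0 x y fxy; apply/eqP; rewrite -subr_eq0; apply/eqP/f0.
by rewrite linearB fxy subrr.
Qed.

Lemma linear_inj0 U V (f : {linear U -> V}) u : injective f -> f u = 0 -> u = 0.
Proof. by move=> finj fu0; apply: finj; rewrite linear0. Qed.

Lemma lift_through_inj U V W (f : {linear U -> V}) (h : {linear W -> V}) :
  injective f -> (forall w, exists u, f u = h w) ->
  exists h' : {linear W -> U}, forall w, f (h' w) = h w.
Proof.
move=> finj /choice[k fk].
have kL : linear k by move=> a x y; apply: finj; rewrite linearP !fk linearP.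
by exists (mk_linear kL).
Qed.

Lemma factor_through_surj U V W (g : {linear U -> V}) (h : {linear U -> W}) :
  surj g -> (forall u, g u = 0 -> h u = 0) ->
  exists h' : {linear V -> W}, forall u, h' (g u) = h u.
Proof.
move=> /choice[k gk] gh.
have hE u : h (k (g u)) = h u.
  by apply/eqP; rewrite -subr_eq0 -linearB gh ?linearB ?gk ?subrr.
have hL : linear (h \o k).
  move=> a x y /=.
  have -> : a *: x + y = g (a *: k x + k y) by rewrite linearP !gk.
  by rewrite hE linearP.
by exists (mk_linear hL) => u; exact: hE.
Qed.

Definition pairl U V W (f : {linear U -> V}) (g : {linear U -> W}) :
    {linear U -> (V * W)%type} :=
  mk_linear (fun a x y => congr2 pair (linearP f a x y) (linearP g a x y)
    : (f (a *: x + y), g (a *: x + y)) = a *: (f x, g x) + (f y, g y)).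

Definition copairl U V W (f : {linear U -> W}) (g : {linear V -> W}) :
    {linear (U * V)%type -> W} := (f \o fst) \+ (g \o snd).

Lemma ker_exact U V (f : {linear U -> V}) :
  injective (\val : ker f -> U) /\ exact_at (\val : {linear ker f -> U}) f.
Proof.
split=> [|u]; first exact: val_inj.
split=> [/eqP fu|[x <-]]; first by exists (Ker fu).
by have /eqP := valP x.
Qed.

Lemma ker_ses U V (f : {linear U -> V}) :
  surj f -> short_exact (\val : {linear ker f -> U}) f.
Proof. by move=> fs; have [] := ker_exact f. Qed.

Lemma coker_pi_linear U V (f : {linear U -> V}) : linear (coker_pi f).
Proof. by move=> a x y; rewrite coker_piD -coker_scaleE. Qed.
Definition coker_proj U V (f : {linear U -> V}) : {linear V -> coker f} :=
  mk_linear (@coker_pi_linear U V f).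

Lemma coker_proj_surj U V (f : {linear U -> V}) : surj (coker_proj f).
Proof. by elim/coker_ind=> v; exists v. Qed.

Lemma coker_proj_eq0 U V (f : {linear U -> V}) v :
  coker_proj f v = 0 <-> exists u, f u = v.
Proof.
rewrite -(linear0 (coker_proj f)) -[v in exists u, _ = v]subr0.
exact: coker_piE.
Qed.

Lemma ses_gf U V W (f : {linear U -> V}) (g : {linear V -> W}) x :
  short_exact f g -> g (f x) = 0.
Proof. by case=> _ fg _; apply/fg; exists x. Qed.

Lemma ses_iso_l U V W X (f : {linear U -> V}) (g : {linear V -> W})
    (h : {linear X -> U}) :
  bijective h -> short_exact f g -> short_exact (f \o h) g.
Proof.
move=> hb [fi fg gs]; split=> //; first exact: inj_comp fi (bij_inj hb).
move=> v; rewrite fg; case: hb => h' _ hK; split=> [[u <-]|[x <-]].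
  by exists (h' u); rewrite /= hK.
by exists (h x).
Qed.

Lemma ses_iso_r U V W X (f : {linear U -> V}) (g : {linear V -> W})
    (h : {linear W -> X}) :
  bijective h -> short_exact f g -> short_exact f (h \o g).
Proof.
move=> hb [fi fg gs]; split=> // [v|x]; last first.
  case: hb => h' hK h'K; have [v gv] := gs (h' x).
  by exists v; rewrite /= gv h'K.
by rewrite -fg /=; split=> [|->]; [exact/linear_inj0/bij_inj | exact: linear0].
Qed.

Lemma isomorphic_sym U V : isomorphic U V -> isomorphic V U.
Proof.
case=> f fb; have [f' fK f'K] := fb.
have f'L : linear f' by move=> a x y; apply: (bij_inj fb); rewrite linearP !f'K.
by exists (mk_linear f'L), f.
Qed.

Lemma inj_surj_bij (U V : Type) (f : U -> V) : injective f -> surj f ->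
  bijective f.
Proof.
move=> fi /choice[g gK]; exists g => // x.
by apply: fi; rewrite gK.
Qed.

Lemma prod_ses U V : short_exact (pairl idfun \0 : {linear U -> (U * V)%type})
  (snd : {linear (U * V)%type -> V}).
Proof.
split=> [x y [] //|[x y] /=|y]; last by exists (0, y).
by split=> [->|[u [_ <-]] //]; exists x.
Qed.

Lemma ses_split_l U V W (f : {linear U -> V}) (g : {linear V -> W})
    (r : {linear V -> U}) :
  short_exact f g -> (forall u, r (f u) = u) ->
  exists s : {linear W -> V}, forall w, g (s w) = w.
Proof.
move=> fg rf; have [fi fgE gs] := fg.
have [|s sg] := @factor_through_surj _ _ _ g (idfun \- (f \o r)) gs.
  by move=> v /fgE[u <-]; rewrite /= rf subrr.
by exists s => w; have [v <-] := gs w;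
  rewrite sg /= linearB (ses_gf _ fg) subr0.
Qed.

Lemma ses_split_r U V W (f : {linear U -> V}) (g : {linear V -> W})
    (s : {linear W -> V}) :
  short_exact f g -> (forall w, g (s w) = w) ->
  exists r : {linear V -> U}, forall u, r (f u) = u.
Proof.
move=> fg gs'; have [fi fgE _] := fg.
have [|r rE] := @lift_through_inj _ _ _ f (idfun \- (s \o g)) fi.
  by move=> v; apply/fgE; rewrite /= linearB gs' subrr.
by exists r => u; apply: fi; rewrite rE /= (ses_gf _ fg) linear0 subr0.
Qed.

Lemma split_ses_iso U V W (f : {linear U -> V}) (g : {linear V -> W})
    (s : {linear W -> V}) :
  short_exact f g -> (forall w, g (s w) = w) -> isomorphic (U * W)%type V.
Proof.
move=> fg sE; have [fi fgE _] := fg; exists (copairl f s).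
apply: inj_surj_bij; first apply: linear_inj => -[x y] /= e0.
  have := congr1 g e0; rewrite linearD sE (ses_gf _ fg) add0r linear0 => y0.
  by move: e0; rewrite y0 linear0 addr0 => /(linear_inj0 fi) ->.
move=> x; have /fgE[y yE] : g (x - s (g x)) = 0 by rewrite linearB sE subrr.
by exists (y, g x); rewrite /= yE subrK.
Qed.

Lemma summand_sub (C : modclass R) U V W (f : {linear U -> V})
    (g : {linear V -> W}) (s : {linear W -> V}) :
  is_class C -> closed_under_summands C -> short_exact f g ->
  (forall w, g (s w) = w) -> C V -> C U.
Proof.
move=> [_ CI] Csum fg sE CV; apply: (Csum U W); apply: CI CV.
exact/isomorphic_sym/(split_ses_iso fg sE).
Qed.

Lemma summand_quot (C : modclass R) U V W (f : {linear U -> V})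
    (g : {linear V -> W}) (s : {linear W -> V}) :
  is_class C -> closed_under_summands C -> short_exact f g ->
  (forall w, g (s w) = w) -> C V -> C W.
Proof.
move=> [C0 CI] Csum fg sE CV; apply: (Csum W U); apply: CI CV.
have [h [h' hK h'K]] := isomorphic_sym (split_ses_iso fg sE).
pose t U' V' : {linear (U' * V')%type -> (V' * U')%type} := pairl snd fst.
exists (t U W \o h); exists (h' \o t W U) => [x|[x y]].
  by rewrite -[LHS]/(h' ((h x).1, (h x).2)) -surjective_pairing hK.
by rewrite -[LHS]/((h (h' (y, x))).2, (h (h' (y, x))).1) h'K.
Qed.

(** Pullback squares, described on elements so that the same lemmas serve any
    concrete model of the pullback. *)
Definition is_pullback X P A W (f : {linear X -> A}) (g : {linear P -> A})
    (p1 : {linear W -> X}) (p2 : {linear W -> P}) :=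
  [/\ forall w, f (p1 w) = g (p2 w),
      forall x y, f x = g y -> exists2 w, p1 w = x & p2 w = y &
      forall w, p1 w = 0 -> p2 w = 0 -> w = 0].

Lemma pullback_sym X P A W (f : {linear X -> A}) (g : {linear P -> A})
    (p1 : {linear W -> X}) (p2 : {linear W -> P}) :
  is_pullback f g p1 p2 -> is_pullback g f p2 p1.
Proof.
move=> [c e i]; split=> // [x y xy|w w2 w1]; last exact: i.
by have [w] := e y x (esym xy); exists w.
Qed.

Lemma pullback_eq X P A W (f : {linear X -> A}) (g : {linear P -> A})
    (p1 : {linear W -> X}) (p2 : {linear W -> P}) w w' :
  is_pullback f g p1 p2 -> p1 w = p1 w' -> p2 w = p2 w' -> w = w'.
Proof.
move=> [_ _ i] e1 e2; apply/eqP; rewrite -subr_eq0; apply/eqP/i.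
  by rewrite linearB e1 subrr.
by rewrite linearB e2 subrr.
Qed.

Lemma pullback_exists X P A (f : {linear X -> A}) (g : {linear P -> A}) :
  exists (W : lmodType R) (p1 : {linear W -> X}) (p2 : {linear W -> P}),
    is_pullback f g p1 p2.
Proof.
pose d := copairl f (\- g); pose i : {linear ker d -> _} := \val.
exists (ker d), (fst \o i), (snd \o i); split=> [w|x y fxy|w w1 w2].
- by apply/eqP; rewrite -subr_eq0; exact: (valP w).
- have d0 : in_ker d (x, y) by rewrite /in_ker /= fxy subrr.
  by exists (Ker d0).
- apply: val_inj => /=; move: w1 w2 => /=.
  by case: (\val w) => ? ? /= -> ->.
Qed.

Lemma pullback_pair X P A W V (f : {linear X -> A}) (g : {linear P -> A})
    (p1 : {linear W -> X}) (p2 : {linear W -> P})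
    (a : {linear V -> X}) (b : {linear V -> P}) :
  is_pullback f g p1 p2 -> (forall v, f (a v) = g (b v)) ->
  exists h : {linear V -> W},
    (forall v, p1 (h v) = a v) /\ (forall v, p2 (h v) = b v).
Proof.
move=> pb ab; have [c e _] := pb.
have /choice[h hE] v : exists w, p1 w = a v /\ p2 w = b v.
  by have [w ? ?] := e _ _ (ab v); exists w.
have hL : linear h.
  move=> x u v; apply: (pullback_eq pb).
    by rewrite (hE _).1 [RHS]linearP !(hE _).1 linearP.
  by rewrite (hE _).2 [RHS]linearP !(hE _).2 linearP.
by exists (mk_linear hL); split=> v; case: (hE v).
Qed.

Lemma pullback_ses X P A W K (f : {linear X -> A}) (g : {linear P -> A})
    (p1 : {linear W -> X}) (p2 : {linear W -> P}) (k : {linear K -> X}) :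
  is_pullback f g p1 p2 -> short_exact k f ->
  exists2 k' : {linear K -> W}, short_exact k' p2 & forall x, p1 (k' x) = k x.
Proof.
move=> pb kf; have [c e _] := pb; have [ki kfE fs] := kf.
have [|h [h1 h2]] := pullback_pair (a := k) (b := \0) pb.
  by move=> x; rewrite (ses_gf _ kf) linear0.
exists h => //; split=> [x y hxy|w|y].
- by apply: ki; rewrite -!h1 hxy.
- split=> [w2|[x <-]]; last by rewrite h2.
  have /kfE[x xw] : f (p1 w) = 0 by rewrite c w2 linear0.
  by exists x; apply: (pullback_eq pb); rewrite ?h1 ?h2.
- by have [x fx] := fs (g y); have [w _ w2] := e _ _ fx; exists w.
Qed.

Definition is_pushout A X Y W (f : {linear A -> X}) (g : {linear A -> Y})
    (j1 : {linear X -> W}) (j2 : {linear Y -> W}) :=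
  [/\ forall a, j1 (f a) = j2 (g a),
      forall x y, j1 x = j2 y -> exists2 a, x = f a & y = g a &
      forall w, exists x y, w = j1 x + j2 y].

Lemma pushout_exists A X Y (f : {linear A -> X}) (g : {linear A -> Y}) :
  exists (W : lmodType R) (j1 : {linear X -> W}) (j2 : {linear Y -> W}),
    is_pushout f g j1 j2.
Proof.
pose d : {linear A -> (X * Y)%type} := pairl f (\- g); pose q := coker_proj d.
have qE x y x' y' : q (x, y) = q (x', y') ->
  exists2 a, x = x' + f a & y = y' - g a.
  move=> /coker_piE[a]; rewrite -[d a]/(f a, - g a) => -[fa ga].
  by exists a; rewrite ?fa ?ga addrC subrK.
exists (coker d), (q \o pairl idfun \0), (q \o pairl \0 idfun).
split=> [a|x y /qE[a xa ya]|w].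
- apply/coker_piE; exists a.
  by rewrite -[LHS]/(f a, - g a) -[RHS]/(f a - 0, 0 - g a) subr0 sub0r.
- exists a; first by rewrite -[x]/(idfun x) xa add0r.
  by apply/esym/eqP; rewrite -subr_eq0 -[_ - _]opprB -[y - g a]ya oppr0.
- have [[x y] <-] := coker_proj_surj w; exists x, y.
  rewrite /= -linearD; congr (coker_proj d _).
  by rewrite -[RHS]/(x + 0, 0 + y) addr0 add0r.
Qed.

Lemma pushout_ses A X Y W K (f : {linear A -> X}) (g : {linear A -> Y})
    (j1 : {linear X -> W}) (j2 : {linear Y -> W}) (p : {linear X -> K}) :
  is_pushout f g j1 j2 -> short_exact f p ->
  exists2 p' : {linear W -> K}, short_exact j2 p' & forall x, p' (j1 x) = p x.
Proof.
move=> [c e s] fp; have [fi fpE ps] := fp.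
have [|[x y] /= e0|p' pE] :=
  @factor_through_surj _ _ _ (copairl j1 j2) (p \o fst).
- by move=> w; have [x [y ->]] := s w; exists (x, y).
- have [|a -> _] := e x (- y); last exact: ses_gf.
  by apply/eqP; rewrite linearN -addr_eq0 e0.
have p1 x : p' (j1 x) = p x.
  by have := pE (x, 0); rewrite /= linear0 addr0.
have p2 y : p' (j2 y) = 0.
  by have := pE (0, y); rewrite /= !linear0 add0r.
exists p' => //; split=> [|w|z]; last by have [x <-] := ps z; exists (j1 x).
- apply: linear_inj => y j2y; have [|a /esym a0 ->] := e 0 y;
    first by rewrite linear0.
  by rewrite (linear_inj0 fi a0) linear0.
- split=> [|[y <-]//]; have [x [y ->]] := s w.
  rewrite linearD p1 p2 addr0 => /fpE[a <-].
  by exists (g a + y); rewrite linearD c.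
Qed.

(** The preimage of a subobject: [K -> X -> B] restricts over [A] inside [B],
    and what is cut off is [C]. *)
Lemma ses_preimage K X A B C (k : {linear K -> X}) (q : {linear X -> B})
    (a : {linear A -> B}) (b : {linear B -> C}) :
  short_exact k q -> short_exact a b ->
  exists (XA : lmodType R) (k' : {linear K -> XA}) (q' : {linear XA -> A})
    (m : {linear XA -> X}),
    [/\ short_exact k' q', short_exact m (b \o q) & forall x, m (k' x) = k x].
Proof.
move=> kq ab; have [W [p1 [p2 pb]]] := pullback_exists q a.
have [k' kp km] := pullback_ses pb kq; exists W, k', p2, p1; split=> //.
have [c e i] := pb; have [ai abE bs] := ab; have [ki kqE qs] := kq.
split=> [|x|z].
- apply: linear_inj => w w1; apply: i => //.
  by apply: (linear_inj0 ai); rewrite -c w1 linear0.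
- rewrite /= abE; split=> [[y ayx]|[w <-]]; last by exists (p2 w).
  by have [w] := e _ _ (esym ayx); exists w.
- by have [y <-] := bs z; have [x <-] := qs y; exists x.
Qed.

Lemma projective_prod P Q : projective P -> projective Q ->
  projective (P * Q)%type.
Proof.
move=> Pp Qp U V f g fs.
have [h hE] := Pp U V f (g \o pairl idfun \0) fs.
have [k kE] := Qp U V f (g \o pairl \0 idfun) fs.
exists (copairl h k) => -[x y]; rewrite /= linearD hE kE /= -linearD.
by congr (g (_, _)); rewrite ?addr0 ?add0r.
Qed.

Lemma projective_split U P (g : {linear U -> P}) : projective P -> surj g ->
  exists s : {linear P -> U}, forall x, g (s x) = x.
Proof. by move=> Pp gs; exact: (Pp U P g idfun gs). Qed.

Lemma projective_retract P Q (s : {linear P -> Q}) (r : {linear Q -> P}) :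
  (forall x, r (s x) = x) -> projective Q -> projective P.
Proof.
move=> rs Qp U V f g fs; have [h hE] := Qp U V f (g \o r) fs.
by exists (h \o s) => x; rewrite /= hE /= rs.
Qed.

Lemma projective_cover_ses A :
  exists (P K : lmodType R) (k : {linear K -> P}) (p : {linear P -> A}),
    projective P /\ short_exact k p.
Proof.
have [P [p [Pp ps]]] := enough_projectives A.
by exists P, (ker p), \val, p; split=> //; exact: ker_ses.
Qed.

(** The middle cover is PA * PC -> B, built from a lift of PC -> C to B. *)
Lemma horseshoe A B C KA PA KC PC (a : {linear A -> B}) (b : {linear B -> C})
    (kA : {linear KA -> PA}) (pA : {linear PA -> A})
    (kC : {linear KC -> PC}) (pC : {linear PC -> C}) :
  projective PC -> short_exact a b -> short_exact kA pA -> short_exact kC pC ->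
  exists (KB : lmodType R) (kB : {linear KB -> (PA * PC)%type})
    (pB : {linear (PA * PC)%type -> B})
    (f : {linear KA -> KB}) (g : {linear KB -> KC}),
    [/\ short_exact kB pB, short_exact f g &
        forall x, kB (f x) = (kA x, 0)].
Proof.
move=> PCp ab kpA kpC; have [ai abE bs] := ab.
have [kAi kpAE pAs] := kpA; have [kCi kpCE pCs] := kpC.
have [h hE] := PCp _ _ b pC bs.
pose pB := copairl (a \o pA) h.
have pBs : surj pB.
  move=> y; have [z zy] := pCs (b y).
  have /abE[x xy] : b (y - h z) = 0 by rewrite linearB hE zy subrr.
  have [w wx] := pAs x; exists (w, z).
  by rewrite /= wx xy subrK.
have kB := ker_ses pBs; have [kBi kBE _] := kB.
have [|f fE] := @lift_through_inj _ _ _ (\val : {linear ker pB -> _})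
  (pairl kA \0) kBi.
  by move=> x; apply/kBE; rewrite /= (ses_gf _ kpA) !linear0 addr0.
have [|g gE] := @lift_through_inj _ _ _ kC
  (snd \o (\val : {linear ker pB -> _})) kCi.
  move=> x; apply/kpCE; rewrite /= -hE.
  have /eqP/(congr1 b) : pB (\val x) == 0 by exact: (valP x).
  by rewrite linear0 /= linearD (ses_gf _ ab) add0r.
exists (ker pB), \val, pB, f, g; split=> //; split=> [|x|z].
- apply: linear_inj => x fx0; apply: (linear_inj0 kAi).
  by have := fE x; rewrite fx0 linear0 => -[].
- split=> [gx0|[w <-]]; last by apply: kCi; rewrite
     gE -[LHS]/(\val (f w)).2 fE linear0.
  have x2 : (\val x).2 = 0 by have := gE x; rewrite gx0 linear0.
  have /eqP : pB (\val x) == 0 by exact: (valP x).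
  rewrite -[pB _]/(a (pA (\val x).1) + h (\val x).2) x2 linear0 addr0.
  move=> /(linear_inj0 ai)/kpAE[w wx]; exists w; apply: val_inj; rewrite fE.
  by rewrite [RHS]surjective_pairing x2 -wx.
- have /abE[x xE] : b (h (kC z)) = 0 by rewrite hE (ses_gf _ kpC).
  have [w wx] := pAs x.
  have /kBE[y yE] : pB (- w, kC z) = 0 by rewrite /= !linearN wx xE addNr.
  by exists y; apply: kCi; rewrite gE -[LHS]/(\val y).2 yE.
Qed.

End LinearMaps.

(** * Dimension shifting in the contravariant variable *)

(** Both Ext^1(A, D) = 0 and Tor_1(M, A) = 0 say that, in every short exact
    sequence ending in A, the monomorphism has a certain property: maps to D
    extend along it, respectively it stays injective after M (x) _. All the
    dimension shifting below uses only the four closure properties that these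
    two classes of maps share. *)
Record pushout_stable (R : pzRingType)
    (sigma : forall U V : lmodType R, {linear U -> V} -> Prop) : Prop := {
  stable_id : forall U, @sigma U U idfun;
  stable_comp : forall (U V W : lmodType R) (f : {linear U -> V})
    (g : {linear V -> W}), sigma _ _ f -> sigma _ _ g -> sigma _ _ (g \o f);
  stable_cancel : forall (U V W : lmodType R) (f : {linear U -> V})
    (g : {linear V -> W}), sigma _ _ (g \o f) -> sigma _ _ f;
  stable_pushout : forall (L P K X : lmodType R) (f : {linear L -> P})
    (u : {linear L -> K}) (h : {linear P -> X}) (k : {linear K -> X}),
    is_pushout f u h k -> sigma _ _ f -> sigma _ _ k
}.

Section Acyclic.
Variables (R : pzRingType).
Variable sigma : forall U V : lmodType R, {linear U -> V} -> Prop.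
Hypothesis sigmaP : pushout_stable sigma.
Implicit Types A B C K P Q U V W X KA KB KC PA PC : lmodType R.

(** For sigma as above, [acyclic i A] is the vanishing of Ext^(i+1)(A, D),
    respectively of Tor_(i+1)(M, A). *)
Fixpoint acyclic (i : nat) (A : lmodType R) : Prop :=
  if i is j.+1 then
    forall (K P : lmodType R) (k : {linear K -> P}) (p : {linear P -> A}),
      projective P -> short_exact k p -> acyclic j K
  else
    forall (K X : lmodType R) (k : {linear K -> X}) (p : {linear X -> A}),
      short_exact k p -> sigma k.

Lemma sigma_comp U V W (f : {linear U -> V}) (g : {linear V -> W})
    (h : {linear U -> W}) :
  (forall x, h x = g (f x)) -> sigma f -> sigma g -> sigma h.
Proof.
move=> hE sf sg; rewrite (_ : h = g \o f); last exact: linear_ext.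
exact: stable_comp.
Qed.

Lemma sigma_cancel U V W (f : {linear U -> V}) (g : {linear V -> W})
    (h : {linear U -> W}) :
  (forall x, h x = g (f x)) -> sigma h -> sigma f.
Proof.
move=> hE; rewrite (_ : h = g \o f); last exact: linear_ext.
exact: stable_cancel.
Qed.

Lemma sigma_split U V (f : {linear U -> V}) (r : {linear V -> U}) :
  (forall u, r (f u) = u) -> sigma f.
Proof.
move=> rf; apply: (@sigma_cancel _ _ _ _ r idfun) => [x|]; first by rewrite rf.
exact: (stable_id sigmaP).
Qed.

(** Every X -> A receives a map from a projective cover P -> A, and X is then
    the pushout of P along the induced map of kernels. *)
Lemma acyclic0_cover A K P (k : {linear K -> P}) (p : {linear P -> A}) :
  projective P -> short_exact k p -> sigma k -> acyclic 0 A.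
Proof.
move=> Pp kp sk K' X k' q kq'; have [ki kpE ps] := kp; have [ki' kqE qs] := kq'.
have [h hE] := Pp _ _ q p qs.
have [|u uE] := @lift_through_inj _ _ _ _ k' (h \o k) ki'.
  by move=> x; apply/kqE; rewrite /= hE (ses_gf _ kp).
apply: (stable_pushout sigmaP (f := k) (u := u) (h := h)) => //; split=> //.
- move=> x y hxy; have /kpE[l lx] : p x = 0 by rewrite -hE hxy (ses_gf _ kq').
  by exists l => //; apply: ki'; rewrite uE /= lx.
- move=> x; have [y yx] := ps (q x).
  have /kqE[z zE] : q (x - h y) = 0 by rewrite linearB hE yx subrr.
  by exists y, z; rewrite zE addrC subrK.
Qed.

Lemma acyclic_iso i A B : isomorphic A B -> acyclic i A -> acyclic i B.
Proof.
move=> /isomorphic_sym[f fb]; case: i => [|i] hA K X k p.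
  by move=> kp; exact: hA (ses_iso_r fb kp).
by move=> Xp kp; exact: hA Xp (ses_iso_r fb kp).
Qed.

Lemma acyclic_projective i P : projective P -> acyclic i P.
Proof.
elim: i P => [|i IH] P Pp K X k p => [kp|Xp kp];
    have [_ _ ps] := kp; have [s sE] := projective_split Pp ps;
    have [r rE] := ses_split_r kp sE; first exact: sigma_split rE.
by apply: IH; exact: projective_retract rE Xp.
Qed.

(** A piece of the long exact sequence, as are the next two lemmas. The
    horseshoe lemma reduces it to degree 1, where KA -> PA is a left factor of
    the composite KA -> KB -> PA * PC. *)
Lemma acyclic_sub i A B C (a : {linear A -> B}) (b : {linear B -> C}) :
  short_exact a b -> acyclic i B -> acyclic i.+1 C -> acyclic i A.
Proof.
elim: i A B C a b => [|i IH] A B C a b ab hB hC.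
  have [PA [KA [kA [pA [PAp kpA]]]]] := projective_cover_ses A.
  have [PC [KC [kC [pC [PCp kpC]]]]] := projective_cover_ses C.
  have [KB [kB [pB [f [g [kpB fg kf]]]]]] := horseshoe PCp ab kpA kpC.
  apply: (acyclic0_cover PAp kpA).
  have : sigma (pairl kA \0 : {linear KA -> (PA * PC)%type}).
    apply: (sigma_comp (f := f) (g := kB)) => //; last exact: hB kpB.
    exact: (hC _ _ _ _ PCp kpC) fg.
  by apply: (sigma_cancel (g := pairl idfun \0)).
move=> KA PA kA pA PAp kpA.
have [PC [KC [kC [pC [PCp kpC]]]]] := projective_cover_ses C.
have [KB [kB [pB [f [g [kpB fg kf]]]]]] := horseshoe PCp ab kpA kpC.
apply: (IH _ _ _ _ _ fg); last exact: hC PCp kpC.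
by apply: hB kpB; exact: projective_prod.
Qed.

(** Over the preimage XA of A, the kernel of X -> B becomes the kernel of
    XA -> A, while XA is itself the kernel of X -> C. *)
Lemma acyclic_extension i A B C (a : {linear A -> B}) (b : {linear B -> C}) :
  short_exact a b -> acyclic i A -> acyclic i C -> acyclic i B.
Proof.
case: i => [|i] ab hA hC K X k q => [kq|Xp kq];
    have [XA [k' [q' [m [kq' mb mk]]]]] := ses_preimage kq ab.
  apply: (sigma_comp (f := k') (g := m)) => //; first exact: hA kq'.
  exact: hC mb.
by apply: (acyclic_sub kq') => //; exact: hC Xp mb.
Qed.

(** Pull a projective cover Q -> C back along B -> C: the pullback is an
    extension of Q by A and of B by the kernel of the cover. *)
Lemma acyclic_quot i A B C (a : {linear A -> B}) (b : {linear B -> C}) :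
  short_exact a b -> acyclic i A -> acyclic i.+1 B -> acyclic i.+1 C.
Proof.
move=> ab hA hB K P k p Pp kp.
have [W [p1 [p2 pb]]] := pullback_exists p b.
have [k' kW _] := pullback_ses pb kp.
have [a' aW _] := pullback_ses (pullback_sym pb) ab.
apply: (acyclic_sub kW) => //.
by apply: (acyclic_extension aW) => //; exact: acyclic_projective.
Qed.

Lemma acyclic_retract i A B (s : {linear A -> B}) (r : {linear B -> A}) :
  (forall x, r (s x) = x) -> acyclic i B -> acyclic i A.
Proof.
elim: i A B s r => [|i IH] A B s r rs hB.
  (* K -> X composed with X -> W is the kernel of W -> B *)
  move=> K X k p kp; have [W [p1 [p2 pb]]] := pullback_exists p r.
  have [k' kW kE] := pullback_ses pb kp.
  have [x|h [h1 h2]] := pullback_pair (a := idfun) (b := s \o p) pb.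
    by rewrite /= rs.
  apply: (sigma_cancel (h := k') (g := h)); last exact: hB kW.
  move=> x; apply: (pullback_eq pb); first by rewrite kE h1.
  by rewrite h2 (ses_gf _ kW) /= (ses_gf _ kp) linear0.
move=> K P k p Pp kp; have [ki kpE ps] := kp.
have [Q [q [Qp qs]]] := enough_projectives B.
(* a cover of B whose kernel visibly has K as a direct factor *)
pose pi : {linear (P * Q)%type -> B} :=
  copairl (s \o p) (q \- (s \o r \o q)).
have pis : surj pi.
  move=> y; have [x xy] := ps (r y); have [z zy] := qs y.
  by exists (x, z); rewrite /= xy zy addrC subrK.
have kpi := ker_ses pis; have [ji jE _] := kpi.
have [|s' s'E] := @lift_through_inj _ _ _ _ (\val : {linear ker pi -> _})
  (pairl k \0) ji.
  by move=> x; apply/jE; rewrite /= (ses_gf _ kp) !linear0 ?subr0 ?addr0.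
have [|r' r'E] := @lift_through_inj _ _ _ _ k
  (fst \o (\val : {linear ker pi -> _})) ki.
  move=> x; apply/kpE.
  have /eqP/(congr1 r) : pi (\val x) == 0 := valP x.
  by rewrite /= linear0 linearD linearB !rs subrr addr0.
apply: (IH _ _ s' r') => [x|]; first by apply: ki;
  rewrite r'E -[LHS]/(\val (s' x)).1 s'E.
by apply: hB kpi; exact: projective_prod.
Qed.

End Acyclic.

(** * Splitting resolutions into short exact sequences *)

Section Splicing.
Variable R : pzRingType.
Implicit Types A B K P Q U V W X : lmodType R.

Section CoRestriction.
Variables (U V W : lmodType R) (f : {linear U -> V}) (g : {linear V -> W}).
Hypothesis gf0 : forall u, g (f u) = 0.

Fact to_ker_subproof u : in_ker g (f u).
Proof. by rewrite /in_ker gf0. Qed.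
Fact to_ker_linear : linear (fun u => Ker (to_ker_subproof u)).
Proof. by move=> a x y; apply: val_inj; rewrite /= linearP. Qed.
Definition to_ker : {linear U -> ker g} := mk_linear to_ker_linear.

Lemma to_ker_eq0 u : to_ker u = 0 <-> f u = 0.
Proof. by split=> [/(congr1 val)//|fu0]; apply: val_inj. Qed.

Lemma to_ker_surj : exact_at f g -> surj to_ker.
Proof.
move=> fg x; have /eqP/fg[u ux] : in_ker g (\val x) by exact: (valP x).
by exists u; apply: val_inj.
Qed.

End CoRestriction.

Section ResolutionTail.
Variables (A : lmodType R) (P : resolution A).

Fact res_aug_d x : res_aug P (res_d P 0 x) = 0.
Proof. by apply/res_exact0; exists x. Qed.
Definition res_tail_aug := to_ker res_aug_d.

Fact res_tail_exact0 : exact_at (res_d P 1) res_tail_aug.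
Proof. by move=> x; rewrite -res_exactS to_ker_eq0. Qed.

Definition res_tail : resolution (ker (res_aug P)) :=
  @Resolution R _ (fun i => P i.+1) (fun i => res_d P i.+1) res_tail_aug
    (to_ker_surj res_aug_d (@res_exact0 _ _ P)) res_tail_exact0
    (fun i => @res_exactS _ _ P i.+1).

End ResolutionTail.

Section ResolutionCons.
Variables (A K P0 : lmodType R) (k : {linear K -> P0}) (p : {linear P0 -> A}).
Hypothesis kp : short_exact k p.
Variable Q : resolution K.

Let obj i : lmodType R := if i is j.+1 then Q j else P0.
Let d i : {linear obj i.+1 -> obj i} :=
  if i is j.+1 then res_d Q j else k \o res_aug Q.

Fact res_cons_exact0 : exact_at (d 0) p.
Proof.
move=> x; have [_ kpE _] := kp; rewrite kpE; split=> [[y <-]|[z <-]].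
  by have [z zy] := @res_aug_surj _ _ Q y; exists z; rewrite /= zy.
by exists (res_aug Q z).
Qed.

Fact res_cons_exactS i : exact_at (d i.+1) (d i).
Proof.
case: i => [|i] x; last exact: res_exactS.
have [ki _ _] := kp; rewrite -res_exact0 /=.
by split=> [/(linear_inj0 ki)|->]; rewrite ?linear0.
Qed.

Definition res_cons : resolution A :=
  @Resolution R A obj d p (let: And3 _ _ ps := kp in ps) res_cons_exact0
    res_cons_exactS.

End ResolutionCons.

Section CoresolutionTail.
Variables (A : lmodType R) (X : coresolution A).

Let i1 : {linear ker (cores_d X 1) -> X 1} := \val.

Fact cores_tail_exact0 : exact_at i1 (cores_d X 1).
Proof. by have [] := ker_exact (cores_d X 1). Qed.

(** Starting at the kernel of the second differential, which is the image of
    the first, keeps all the terms of the tail unchanged. *)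
Definition cores_tail : coresolution (ker (cores_d X 1)) :=
  @Coresolution R _ (fun i => X i.+1) (fun i => cores_d X i.+1) i1
    val_inj cores_tail_exact0 (fun i => @cores_exactS _ _ X i.+1).

Fact cores_d01 x : cores_d X 1 (cores_d X 0 x) = 0.
Proof. by apply/cores_exactS; exists x. Qed.

Lemma cores_tail_ses : short_exact (cores_aug X) (to_ker cores_d01).
Proof.
split; first exact: cores_aug_inj; last first.
  by apply: to_ker_surj; exact: cores_exactS.
by move=> x; rewrite to_ker_eq0; exact: cores_exact0.
Qed.

End CoresolutionTail.

Section CoresolutionCons.
Variables (A K X0 : lmodType R) (f : {linear A -> X0}) (g : {linear X0 -> K}).
Hypothesis fg : short_exact f g.
Variable Q : coresolution K.

Let obj i : lmodType R := if i is j.+1 then Q j else X0.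
Let d i : {linear obj i -> obj i.+1} :=
  if i is j.+1 then cores_d Q j else cores_aug Q \o g.

Fact cores_cons_exact0 : exact_at f (d 0).
Proof.
move=> x; have [_ fgE _] := fg; rewrite -fgE /=.
split=> [|->]; last by rewrite linear0.
exact/linear_inj0/cores_aug_inj.
Qed.

Fact cores_cons_exactS i : exact_at (d i) (d i.+1).
Proof.
case: i => [|i] x; last exact: cores_exactS.
have [_ _ gs] := fg; rewrite /d cores_exact0; split=> [[y <-]|[z <-]].
  by have [z zy] := gs y; exists z; rewrite /= zy.
by exists (g z).
Qed.

Definition cores_cons : coresolution A :=
  @Coresolution R A obj d f (let: And3 fi _ _ := fg in fi) cores_cons_exact0
    cores_cons_exactS.

End CoresolutionCons.

(** ** Finite resolutions *)

Implicit Types C : modclass R.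

(** The classes of modules with a C-resolution, respectively coresolution, of
    length k, cut into short exact sequences. *)
Fixpoint wedge_len C (k : nat) (A : lmodType R) : Prop :=
  if k is j.+1 then
    exists (K X : lmodType R) (f : {linear K -> X}) (g : {linear X -> A}),
      [/\ short_exact f g, C X & wedge_len C j K]
  else C A.

Fixpoint vee_len C (k : nat) (A : lmodType R) : Prop :=
  if k is j.+1 then
    exists (X K : lmodType R) (f : {linear A -> X}) (g : {linear X -> K}),
      [/\ short_exact f g, C X & vee_len C j K]
  else C A.

Definition zero_obj : lmodType R := ker (idfun : {linear R^o -> R^o}).

Lemma zero_objP : zero_module zero_obj.
Proof. by move=> x; apply: val_inj; apply/eqP; exact: (valP x). Qed.

Lemma wedge_lenS C k A : is_class C -> wedge_len C k A -> wedge_len C k.+1 A.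
Proof.
move=> [C0 CI]; elim: k A => [|k IH] A.
  move=> CA; exists zero_obj, A, \0, idfun; split=> //; last exact/C0/zero_objP.
  split=> [x y _|x|x]; [by rewrite (zero_objP x) (zero_objP y)| |by exists x].
  by split=> [/= ->|[y <-]//]; exists 0.
by move=> [K [X [f [g [fg CX wK]]]]]; exists K, X, f, g; split=> //; exact: IH.
Qed.

Lemma vee_lenS C k A : is_class C -> vee_len C k A -> vee_len C k.+1 A.
Proof.
move=> [C0 CI]; elim: k A => [|k IH] A.
  move=> CA; exists A, zero_obj, idfun, \0; split=> //; last exact/C0/zero_objP.
  split=> [x y //|x|x]; last by exists 0; rewrite (zero_objP x).
  by split=> // _; exists x.
by move=> [X [K [f [g [fg CX wK]]]]]; exists X, K, f, g; split=> //; exact: IH.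
Qed.

Lemma wedgeP C m A : is_class C -> wedge C m A <-> wedge_len C m A.
Proof.
move=> Cc; have [C0 CI] := Cc; split=> [[k km]|].
  suff: (exists X : resolution A, (forall i, (i <= k)%N -> C (X i)) /\
      (forall i, (k < i)%N -> zero_module (X i))) -> wedge_len C k A.
    move=> h /h; rewrite -(subnK km); elim: (m - k)%N => // j IH /IH.
    exact: wedge_lenS.
  elim: k A {km} => [|k IH] A [X [XC X0]].
    apply: (CI (X 0)) (XC 0%N _) => //; exists (res_aug X).
    apply: inj_surj_bij; last exact: res_aug_surj.
    apply: linear_inj => x /res_exact0[y <-].
    by rewrite (X0 1%N _ y) ?linear0.
  exists (ker (res_aug X)), (X 0%N), \val, (res_aug X); split.
  - by apply: ker_ses; exact: res_aug_surj.
  - exact: XC.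
  - apply: IH; exists (res_tail X).
    by split=> i; [exact: (XC i.+1) | exact: (X0 i.+1)].
move=> wA; exists m => //; elim: m A wA => [|m IH] A.
  move=> CA; pose obj i : lmodType R := if i is 0 then A else zero_obj.
  have z i (x : obj i.+1) : x = 0 by exact: zero_objP.
  have e0 : exact_at (\0 : {linear obj 1%N -> obj 0%N})
                     (idfun : {linear A -> A}).
    by move=> x; split=> [/= ->|[y <-]//]; exists 0.
  have eS i : exact_at (\0 : {linear obj i.+2 -> obj i.+1})
                       (\0 : {linear obj i.+1 -> obj i}).
    by move=> x; split=> // _; exists 0; rewrite (z _ x).
  have s : surj (idfun : {linear A -> A}) by move=> x; exists x.
  exists (@Resolution R A obj (fun=> \0) idfun s e0 eS).
  by split=> -[|i] //= _; exact: zero_objP.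
move=> [K [X [f [g [fg CX /IH[Q [QC Q0]]]]]]]; exists (res_cons fg Q).
by split=> -[|i] //; [exact: QC | exact: Q0].
Qed.

Lemma veeP C m A : is_class C -> vee C m A <-> vee_len C m A.
Proof.
move=> Cc; have [C0 CI] := Cc; split=> [[k km]|].
  suff: (exists X : coresolution A, (forall i, (i <= k)%N -> C (X i)) /\
      (forall i, (k < i)%N -> zero_module (X i))) -> vee_len C k A.
    move=> h /h; rewrite -(subnK km); elim: (m - k)%N => // j IH /IH.
    exact: vee_lenS.
  elim: k A {km} => [|k IH] A [X [XC X0]].
    apply: (CI (X 0)) (XC 0%N _) => //; apply: isomorphic_sym.
    exists (cores_aug X); apply: inj_surj_bij; first exact: cores_aug_inj.
    by move=> x; apply/cores_exact0; exact: (X0 1%N).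
  exists (X 0%N), (ker (cores_d X 1)), (cores_aug X),
    (to_ker (cores_d01 (X := X))).
  split; first exact: cores_tail_ses; first exact: XC.
  apply: IH; exists (cores_tail X).
  by split=> i; [exact: (XC i.+1) | exact: (X0 i.+1)].
move=> wA; exists m => //; elim: m A wA => [|m IH] A.
  move=> CA; pose obj i : lmodType R := if i is 0 then A else zero_obj.
  have z i (x : obj i.+1) : x = 0 by exact: zero_objP.
  have e0 : exact_at (idfun : {linear A -> A})
                     (\0 : {linear obj 0%N -> obj 1%N}).
    by move=> x; split=> // _; exists x.
  have eS i : exact_at (\0 : {linear obj i -> obj i.+1})
                       (\0 : {linear obj i.+1 -> obj i.+2}).
    by move=> x; split=> // _; exists 0; rewrite (z _ x).
  have s : injective (idfun : {linear A -> A}) by [].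
  exists (@Coresolution R A obj (fun=> \0) idfun s e0 eS).
  by split=> -[|i] //= _; exact: zero_objP.
move=> [X [K [f [g [fg CX /IH[Q [QC Q0]]]]]]]; exists (cores_cons fg Q).
by split=> -[|i] //; [exact: QC | exact: Q0].
Qed.

Lemma wedge_len_iso C k A B :
  is_class C -> isomorphic A B -> wedge_len C k A -> wedge_len C k B.
Proof.
move=> [_ CI] AB; case: k => [|k]; first exact: CI.
have [h hb] := AB; move=> [K [X [f [g [fg CX wK]]]]].
by exists K, X, f, (h \o g); split=> //; exact: ses_iso_r.
Qed.

Lemma vee_len_iso C k A B :
  is_class C -> isomorphic A B -> vee_len C k A -> vee_len C k B.
Proof.
move=> [_ CI] AB; case: k => [|k]; first exact: CI.
have [h hb] := isomorphic_sym AB; move=> [X [K [f [g [fg CX wK]]]]].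
by exists X, K, (f \o h), g; split=> //; exact: ses_iso_l.
Qed.

End Splicing.

(** * Ext *)

Section Ext.
Variable R : pzRingType.
Implicit Types A B C D K P U V W X : lmodType R.

Definition extends (D U V : lmodType R) (f : {linear U -> V}) : Prop :=
  forall g : {linear U -> D},
    exists h : {linear V -> D}, forall u, h (f u) = g u.

Lemma extends_stable D : pushout_stable (extends D).
Proof.
split=> [U g|U V W f g fE gE k|U V W f g gfE k|L P K X f u h k [hk cap cup]
  fE phi].
- by exists g.
- have [l lE] := fE k; have [m mE] := gE l.
  by exists m => x; rewrite /= mE lE.
- by have [m mE] := gfE k; exists (m \o g) => x; exact: mE.
have [psi psiE] := fE (phi \o u).
have [||m mE] := @factor_through_surj _ _ _ _ (copairl h k) (copairl psi phi).
- by move=> x; have [p [y ->]] := cup x; exists (p, y).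
- move=> [p y] /= hpky; have : h p = k (- y).
    by apply/eqP; rewrite linearN -addr_eq0 hpky.
  move=> /cap[l -> /eqP]; rewrite eqr_oppLR => /eqP ->.
  by rewrite psiE /= linearN subrr.
- exists m => y; have := mE (0, y).
  by rewrite /= !linear0 !add0r.
Qed.

(** Dropping the first term of a projective resolution of A shifts degree i+2
    of A to degree i+1 of a first syzygy, and every projective resolution of a
    first syzygy arises in this way. As both sides quantify over all choices,
    no comparison of resolutions is involved. *)
Lemma Ext_acyclic i A D : Ext_vanishes i.+1 A D <-> acyclic (@extends D) i A.
Proof.
elim: i A => [|i IH] A; split=> [vA|aA].
- have [P Pp] := projective_resolution_exists A.
  apply: (acyclic0_cover (extends_stable D) (Pp 0%N)).
    exact: ker_ses (@res_aug_surj _ _ P).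
  move=> g; have [|h hE] := vA P Pp (g \o res_tail_aug P).
    move=> x; rewrite /= (_ : res_tail_aug P _ = 0) ?linear0//.
    by apply/res_tail_exact0; exists x.
  exists h => x; have [y <-] := @res_aug_surj _ _ (res_tail P) x.
  by rewrite -hE.
- move=> P Pp f f0.
  have [|g gE] := @factor_through_surj _ _ _ _ (res_tail_aug P) f
    (@res_aug_surj _ _ (res_tail P)).
    by move=> x /res_tail_exact0[y <-].
  have [h hE] := aA _ _ _ _ (ker_ses (@res_aug_surj _ _ P)) g.
  by exists h => x; rewrite -gE -hE.
- move=> K P k p Pp kp; apply/IH => Q Qp.
  by apply: (vA (res_cons kp Q)) => -[|j] //; exact: Qp.
- move=> P Pp; apply: ((IH _).2 (aA _ _ _ _ (Pp 0%N) _) (res_tail P)).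
    exact: ker_ses (@res_aug_surj _ _ P).
  by move=> j; exact: (Pp j.+1).
Qed.

Lemma res_dd A (P : resolution A) i x : res_d P i (res_d P i.+1 x) = 0.
Proof. by apply/(@res_exactS _ _ P i); exists x. Qed.

(** The pullback of U -> V -> W along h splits. *)
Lemma Ext1_lift A U V W (f : {linear U -> V}) (g : {linear V -> W})
    (h : {linear A -> W}) :
  Ext_vanishes 1 A U -> short_exact f g ->
  exists h' : {linear A -> V}, forall x, g (h' x) = h x.
Proof.
move=> /(Ext_acyclic 0) vA fg; have [X [p1 [p2 pb]]] := pullback_exists g h.
have [k kX kE] := pullback_ses pb fg; have [r rE] := vA _ _ _ _ kX idfun.
have [s sE] := ses_split_l kX rE; have [c _ _] := pb.
by exists (p1 \o s) => x; rewrite /= c sE.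
Qed.

Lemma Ext1_split A U V (f : {linear U -> V}) (g : {linear V -> A}) :
  Ext_vanishes 1 A U -> short_exact f g ->
  exists s : {linear A -> V}, forall x, g (s x) = x.
Proof. by move=> vA fg; exact: (Ext1_lift idfun vA fg). Qed.

Lemma Ext_retract i A B (s : {linear A -> B}) (r : {linear B -> A}) D :
  (forall x, r (s x) = x) -> Ext_vanishes i.+1 B D -> Ext_vanishes i.+1 A D.
Proof.
move=> rs /Ext_acyclic vB; apply/Ext_acyclic.
exact: (acyclic_retract (extends_stable D) rs vB).
Qed.

(** ** The long exact sequence in the covariant variable *)

(** A fixed projective resolution P of A suffices here: cocycles are lifted
    along g because the terms of P are projective, and the differences between
    lifts land in U. *)
Section Covariant.
Variables (i : nat) (A U V W : lmodType R).
Variables (f : {linear U -> V}) (g : {linear V -> W}).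
Hypothesis fg : short_exact f g.

Lemma Ext_covariant_extension :
  Ext_vanishes i.+1 A U -> Ext_vanishes i.+1 A W -> Ext_vanishes i.+1 A V.
Proof.
have [fi fgE gs] := fg; move=> vU vW P Pp c c0.
have [|b bE] := vW P Pp (g \o c) => [x|]; first by rewrite /= c0 linear0.
have [b' b'E] := Pp i V W g b gs.
have [|e eE] := @lift_through_inj _ _ _ _ f (c \- (b' \o res_d P i)) fi.
  by move=> x; apply/fgE; rewrite /= linearB b'E -bE subrr.
have [|d dE] := vU P Pp e => [x|].
  apply: fi; rewrite eE linear0 /= c0.
  by rewrite res_dd linear0 subr0.
exists (b' \+ (f \o d)) => x; rewrite /= -dE eE /= addrC subrK //.
Qed.

Lemma Ext_covariant_quot :
  Ext_vanishes i.+1 A V -> Ext_vanishes i.+2 A U -> Ext_vanishes i.+1 A W.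
Proof.
have [fi fgE gs] := fg; move=> vV vU P Pp c c0.
have [b bE] := Pp i.+1 V W g c gs.
have [|e eE] := @lift_through_inj _ _ _ _ f (b \o res_d P i.+1) fi.
  by move=> x; apply/fgE; rewrite /= bE c0.
have [|d dE] := vU P Pp e => [x|].
  by apply: fi; rewrite eE linear0 /= res_dd linear0.
have [|a aE] := vV P Pp (b \- (f \o d)) => [x|].
  by rewrite /= -dE eE /= subrr.
exists (g \o a) => x.
by rewrite /= -aE /= linearB bE (ses_gf _ fg) subr0.
Qed.

End Covariant.

Lemma Ext_covariant_retract i A B C (s : {linear B -> C})
    (r : {linear C -> B}) :
  (forall x, r (s x) = x) -> Ext_vanishes i.+1 A C -> Ext_vanishes i.+1 A B.
Proof.
move=> rs vC P Pp f f0; have [|g gE] := vC P Pp (s \o f) => [x|].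
  by rewrite /= f0 linear0.
by exists (r \o g) => x; rewrite /= -gE /= rs.
Qed.

(** ** Vanishing against finite resolutions and coresolutions *)

(** Each step of the resolution costs one degree; the same holds for the
    coresolutions in the next lemma. *)
Lemma Ext_wedge_len n k i A F (D : modclass R) :
  (forall j X, (1 <= j <= n)%N -> D X -> Ext_vanishes j A X) ->
  wedge_len D k F -> (1 <= i)%N -> (i + k <= n)%N -> Ext_vanishes i A F.
Proof.
move=> vD; elim: k i F => [|k IH] [//|i] F.
  by move=> DF _; rewrite addn0 => /= h; apply: vD.
move=> [K [X [f [g [fg DX wK]]]]] _ ikn.
have vX : Ext_vanishes i.+1 A X.
  by apply: vD => //=; apply: leq_trans ikn; rewrite leq_addr.
apply: (Ext_covariant_quot fg vX).
by apply: IH => //; rewrite addSnnS.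
Qed.

Lemma Ext_vee_len n k i E B (C : modclass R) :
  (forall j X, (1 <= j <= n)%N -> C X -> Ext_vanishes j X B) ->
  vee_len C k E -> (1 <= i)%N -> (i + k <= n)%N -> Ext_vanishes i E B.
Proof.
move=> vC; elim: k i E => [|k IH] [//|i] E.
  by move=> CE _; rewrite addn0 => /= h; apply: vC.
move=> [X [K [f [g [fg CX wK]]]]] _ ikn; apply/Ext_acyclic.
apply: (acyclic_sub (extends_stable B) fg); apply/Ext_acyclic.
  by apply: vC => //=; apply: leq_trans ikn; rewrite leq_addr.
by apply: IH => //; rewrite addSnnS.
Qed.

(** ** The orthogonal classes of an n-cotorsion pair *)

(** The approximation K -> X -> A splits because Ext^1(A, K) = 0, by dimension
    shifting along the D-resolution of K; so A is a direct summand of X. *)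
Lemma left_cotorsion_orthogonal n (C D : modclass R) A :
  (1 <= n)%N -> left_cotorsion_pair n C D ->
  (forall i X, (1 <= i <= n)%N -> D X -> Ext_vanishes i A X) -> C A.
Proof.
move=> n1 [Cc Dc Csum _ app] vA; have [K [X [f [g [fg CX]]]]] := app A.
move=> /(wedgeP _ _ Dc) wK.
have vK : Ext_vanishes 1 A K.
  by apply: (Ext_wedge_len vA wK); rewrite // add1n prednK.
by have [s sE] := Ext1_split vK fg; exact: summand_quot Cc Csum fg sE CX.
Qed.

(** Dually, B -> X -> K splits because Ext^1(K, B) = 0. *)
Lemma right_cotorsion_orthogonal n (C D : modclass R) B :
  (1 <= n)%N -> right_cotorsion_pair n C D ->
  (forall i X, (1 <= i <= n)%N -> C X -> Ext_vanishes i X B) -> D B.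
Proof.
move=> n1 [Cc Dc Dsum _ app] vB; have [X [K [f [g [fg DX]]]]] := app B.
move=> /(veeP _ _ Cc) wK.
have vK : Ext_vanishes 1 K B.
  by apply: (Ext_vee_len vB wK); rewrite // add1n prednK.
by have [s sE] := Ext1_split vK fg; exact: summand_sub Dc Dsum fg sE DX.
Qed.

End Ext.

(** * Tensor products and Tor *)

Section Tor.
Variables (R : pzRingType) (M : bimodType R).
Implicit Types A B C K P U V W X : lmodType R.

Lemma tensor_map_eq0 U V (f : {linear U -> V}) t :
  (forall u, f u = 0) -> tensor_map M f t = 0.
Proof.
move=> f0; elim/tensor_ind: t => [|s t hs ht|m x]; first exact: linear0.
  by rewrite linearB hs ht subrr.
have e0 : tens m 0 = 0 :> tensor M V.
  by apply: (addrI (tens m 0)); rewrite -tensDr !addr0.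
by rewrite tensor_mapE f0.
Qed.

Lemma tensor_map_comp U V W (f : {linear U -> V}) (g : {linear V -> W})
    (h : {linear U -> W}) t :
  (forall u, h u = g (f u)) ->
    tensor_map M h t = tensor_map M g (tensor_map M f t).
Proof.
move=> hE; elim/tensor_ind: t => [|s t hs ht|m x]; first by rewrite !linear0.
  by rewrite !linearB hs ht.
by rewrite !tensor_mapE hE.
Qed.

Lemma tensor_map_id U (f : {linear U -> U}) t :
  (forall u, f u = u) -> tensor_map M f t = t.
Proof.
move=> fE; elim/tensor_ind: t => [|s t hs ht|m x]; first by rewrite linear0.
  by rewrite linearB hs ht.
by rewrite tensor_mapE fE.
Qed.

Lemma tensor_map_surj U V (f : {linear U -> V}) : surj f ->
  surj (tensor_map M f).
Proof.
move=> fs; elim/tensor_ind=> [|_ _ [s <-] [t <-]|m x].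
- by exists 0; rewrite linear0.
- by exists (s - t); rewrite linearB.
- by have [y <-] := fs x; exists (tens m y); rewrite tensor_mapE.
Qed.

Lemma tensor_map_exact U V W (f : {linear U -> V}) (g : {linear V -> W}) :
  exact_at f g -> surj g -> exact_at (tensor_map M f) (tensor_map M g).
Proof.
move=> fg /choice[h hE] t; split=> [gt0|[s <-]]; last first.
  rewrite -(tensor_map_comp (h := g \o f))//.
  by apply: tensor_map_eq0 => u; apply/fg; exists u.
(* w |-> tens m (h w) is well defined modulo the image of M (x) f, which
   yields an inverse of the map induced by M (x) g on the cokernel *)
pose q := coker_proj (tensor_map M f).
have qE m v v' : g v = g v' -> q (tens m v) = q (tens m v').
  move=> gvv'; have /fg[u uE] : g (v - v') = 0 by rewrite linearB gvv' subrr.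
  have -> : v = v' + f u by rewrite uE addrC subrK.
  have qf : q (tensor_map M f (tens m u)) = 0.
    by apply/coker_proj_eq0; exists (tens m u).
  by rewrite tensDr linearD -tensor_mapE qf addr0.
have phiP : balanced (fun (m : M) w => q (tens m (h w))).
  split=> [m n w|m w w'|m a w]; first by rewrite tensDl linearD.
    by rewrite -linearD -tensDr; apply: qE; rewrite linearD !hE.
  by rewrite tensZ; apply: qE; rewrite linearZ /= !hE.
have : tensor_lift_add phiP (tensor_map M g t) = q t.
  elim/tensor_ind: t {gt0} => [|s t hs ht|m v];
    first by rewrite !linear0 raddf0.
    by rewrite !linearB raddfB hs ht.
  by rewrite tensor_mapE tensor_lift_addE; apply: qE; rewrite hE.
by rewrite gt0 raddf0 => /esym/coker_proj_eq0.
Qed.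

Definition tensor_mono U V (f : {linear U -> V}) : Prop :=
  injective (tensor_map M f).

(** Stability under pushouts is the only nonformal part. A pushout X is the
    cokernel of L -> P * K, so right exactness of M (x) _ expresses an element
    of M (x) K that dies in M (x) X by an element of M (x) L. *)
Lemma tensor_mono_stable : pushout_stable tensor_mono.
Proof.
split=> [U x y|U V W f g fi gi x y|U V W f g gfi x y exy|
         L P K X f u h k [hk cap cup] fi].
- by rewrite !tensor_map_id.
- by rewrite !(tensor_map_comp (f := f) (g := g))// => /gi/fi.
- by apply: gfi; rewrite !(tensor_map_comp (f := f) (g := g))// exy.
apply: linear_inj => t kt0.
pose j : {linear K -> (P * K)%type} := pairl \0 idfun.
pose d : {linear L -> (P * K)%type} := pairl f (\- u).
pose c : {linear (P * K)%type -> X} := copairl h k.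
have dc : exact_at d c.
  move=> [p y]; split=> [/= hpky|[l [<- <-]]];
    last by rewrite /= hk linearN subrr.
  have /cap[l -> ny] : h p = k (- y).
    by apply/eqP; rewrite linearN -addr_eq0 hpky.
  by exists l; rewrite -[LHS]/(f l, - u l) -ny opprK.
have cs : surj c by move=> x; have [p [y ->]] := cup x; exists (p, y).
have : tensor_map M c (tensor_map M j t) = 0.
  by rewrite -(tensor_map_comp (h := k))// => y; rewrite /= linear0 add0r.
move=> /(tensor_map_exact dc cs)[s sE].
have s0 : s = 0.
  apply: fi; rewrite linear0 (tensor_map_comp (f := d) (g := fst))// sE.
  by rewrite -(tensor_map_comp (h := fst \o j))// tensor_map_eq0.
rewrite -[t](tensor_map_id (f := snd \o j))//
  (tensor_map_comp (f := j) (g := snd))//.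
by rewrite -sE s0 !linear0.
Qed.

(** In degree 1, right exactness turns exactness of the tensored resolution at
    M (x) P1 into injectivity of M (x) K -> M (x) P0 for the first syzygy K
    of A; then the degree is shifted as for Ext. *)
Lemma Tor_acyclic i A : Tor_vanishes i.+1 M A <-> acyclic tensor_mono i A.
Proof.
have split_d (P : resolution A) t : tensor_map M (res_d P 0) t =
    tensor_map M (\val : {linear ker (res_aug P) -> P 0%N})
      (tensor_map M (res_tail_aug P) t).
  exact: tensor_map_comp.
elim: i A split_d => [|i IH] A split_d; split=> [vA|aA].
- have [P Pp] := projective_resolution_exists A.
  apply: (acyclic0_cover tensor_mono_stable (Pp 0%N)).
    exact: ker_ses (@res_aug_surj _ _ P).
  apply: linear_inj => t t0.
  have [s sE] := tensor_map_surj (@res_aug_surj _ _ (res_tail P)) t.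
  have /(vA P Pp)[r rE] : tensor_map M (res_d P 0) s = 0.
    by rewrite split_d -[tensor_map M (res_tail_aug P) s]/(_ s) sE.
  rewrite -sE; apply/(tensor_map_exact (@res_tail_exact0 _ _ P)).
    exact: (@res_aug_surj _ _ (res_tail P)).
  by exists r.
- move=> P Pp t.
  rewrite -(tensor_map_exact (@res_tail_exact0 _ _ P)
    (@res_aug_surj _ _ (res_tail P))).
  rewrite split_d; split=> [|->]; last exact: linear0.
  exact: linear_inj0 (aA _ _ _ _ (ker_ses (@res_aug_surj _ _ P))).
- move=> K P k p Pp kp; apply/IH => [Q t|Q Qp]; first exact: tensor_map_comp.
  by apply: (vA (res_cons kp Q)) => -[|j] //; exact: Qp.
- move=> P Pp; apply: ((IH _ _).2 (aA _ _ _ _ (Pp 0%N) _) (res_tail P)).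
  + by move=> Q t; exact: tensor_map_comp.
  + exact: ker_ses (@res_aug_surj _ _ P).
  + by move=> j; exact: (Pp j.+1).
Qed.

Lemma tensor_ses A B C (f : {linear A -> B}) (g : {linear B -> C}) :
  Tor_vanishes 1 M C -> short_exact f g ->
  short_exact (tensor_map M f) (tensor_map M g).
Proof.
move=> /(Tor_acyclic 0) vC fg; have [fi fgE gs] := fg.
by split; [exact: vC fg | exact: tensor_map_exact | exact: tensor_map_surj].
Qed.

Lemma Tor_vee_len n k i E (C : modclass R) :
  (forall j X, (1 <= j <= n)%N -> C X -> Tor_vanishes j M X) ->
  vee_len C k E -> (1 <= i)%N -> (i + k <= n)%N -> Tor_vanishes i M E.
Proof.
move=> vC; elim: k i E => [|k IH] [//|i] E.
  by move=> CE _; rewrite addn0 => /= h; apply: vC.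
move=> [X [K [f [g [fg CX wK]]]]] _ ikn; apply/Tor_acyclic.
apply: (acyclic_sub tensor_mono_stable fg); apply/Tor_acyclic.
  by apply: vC => //=; apply: leq_trans ikn; rewrite leq_addr.
by apply: IH => //; rewrite addSnnS.
Qed.

End Tor.

(** * Modules over the trivial extension *)

Section TrivextModules.
Variables (R : pzRingType) (M : bimodType R).
Notation S := (trivext M).
Implicit Types X Y Z : lmodType S.
Implicit Types N A B C : lmodType R.

Definition restr_map X Y (f : {linear X -> Y}) : {linear restr X -> restr Y} :=
  mk_linear (fun a x y => linearP f ((a, 0) : S) x y
    : (f : restr X -> restr Y) (a *: (x : restr X) + y) = a *: (f x : restr Y)
      + f y).

Lemma restr_mapE X Y (f : {linear X -> Y}) x : restr_map f x = f x.
Proof. by []. Qed.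

Lemma restr_ses X Y Z (f : {linear X -> Y}) (g : {linear Y -> Z}) :
  short_exact f g -> short_exact (restr_map f) (restr_map g).
Proof. by []. Qed.

Lemma mact_map X Y (f : {linear X -> Y}) m (x : restr X) :
  f (mact m x) = mact m (f x : restr Y).
Proof. by rewrite /mact linearZ. Qed.

Lemma mact_mact X m m' (x : restr X) : mact m (mact m' x) = 0.
Proof.
rewrite /mact scalerA trivext_ME /= mulr0 scale0r rscale0r addr0.
exact: scale0r.
Qed.

Lemma mact0r X m : mact m (0 : restr X) = 0.
Proof. by rewrite /mact scaler0. Qed.

Lemma mactBr X m (x y : restr X) : mact m (x - y) = mact m x - mact m y.
Proof. by rewrite /mact scalerBr. Qed.

Lemma trivext_scaleE X (s : S) (x : X) :
  s *: x = s.1 *: (x : restr X) + mact s.2 (x : restr X).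
Proof.
transitivity ((((s.1, 0) : S) + ((0, s.2) : S)) *: x); last exact: scalerDl.
by congr (_ *: _); rewrite trivext_DE /= addr0 add0r; case: s.
Qed.

Lemma alpha_map X Y (f : {linear X -> Y}) t :
  f (alpha X t) = alpha Y (tensor_map M (restr_map f) t).
Proof.
rewrite -[LHS]/(restr_map f _).
elim/tensor_ind: t => [|s t hs ht|m x]; first by rewrite !linear0.
  by rewrite !linearB hs ht.
by rewrite tensor_mapE !alphaE -mact_map.
Qed.

Lemma alpha_alpha X t : alpha X (tensor_map M (alpha X) t) = 0.
Proof.
elim/tensor_ind: t => [|s t hs ht|m t]; first by rewrite !linear0.
  by rewrite !linearB hs ht subrr.
rewrite tensor_mapE alphaE; elim/tensor_ind: t => [|s t hs ht|n x].
- by rewrite linear0 mact0r.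
- by rewrite linearB mactBr hs ht subrr.
- by rewrite alphaE mact_mact.
Qed.

Lemma mact_alpha X m t : mact m (alpha X t) = 0.
Proof. by rewrite -alphaE -tensor_mapE alpha_alpha. Qed.

Section LinearOfRestr.
Variables (X Y : lmodType S) (f : {linear restr X -> restr Y}).
Hypothesis fm : forall m (x : restr X), f (mact m x) = mact m (f x).

Fact trivext_linear_subproof : linear (f : X -> Y).
Proof.
move=> s x y; rewrite !trivext_scaleE.
have -> : f (s.1 *: (x : restr X) + mact s.2 (x : restr X) + (y : restr X)) =
    f (s.1 *: (x : restr X)) + f (mact s.2 (x : restr X))
      + f y by rewrite !linearD.
by rewrite fm linearZ.
Qed.
Definition trivext_linear : {linear X -> Y} :=
    mk_linear trivext_linear_subproof.

End LinearOfRestr.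

(** ** Modules given by an action of M of square zero *)

Section Construction.
Variables (X : lmodType R) (act : M -> X -> X).
Hypotheses (actB : balanced act)
  (actZ : forall a m x, act (a *: m) x = a *: act m x)
  (act2 : forall m m' x, act m (act m' x) = 0).

Definition trivext_module : Type := let _ := (actB, actZ, act2) in X.

HB.instance Definition _ := GRing.Zmodule.copy trivext_module X.

Let actDl m n x : act (m + n) x = act m x + act n x. Proof. by case: actB. Qed.
Let actDr m x y : act m (x + y) = act m x + act m y. Proof. by case: actB. Qed.
Let actr m a x : act (rscale m a) x = act m (a *: x). Proof. by case: actB. Qed.
Let act0 x : act 0 x = 0.
Proof. by apply: (addrI (act 0 x)); rewrite -actDl !addr0. Qed.

Definition trivext_module_scale (s : S) (x : trivext_module) : trivext_module :=
  s.1 *: (x : X) + act s.2 x.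

Fact trivext_module_scaleA s t x :
  trivext_module_scale s (trivext_module_scale t x)
    = trivext_module_scale (s * t) x.
Proof.
rewrite /trivext_module_scale trivext_ME /= scalerDr scalerA actDr act2 addr0.
by rewrite actDl actZ actr addrA.
Qed.
Fact trivext_module_scale1 : left_id 1 trivext_module_scale.
Proof. by move=> x; rewrite /trivext_module_scale scale1r act0 addr0. Qed.
Fact trivext_module_scaleDr : right_distributive trivext_module_scale +%R.
Proof.
by move=> s x y; rewrite /trivext_module_scale scalerDr actDr addrACA.
Qed.
Fact trivext_module_scaleDl x : {morph trivext_module_scale^~ x : s t / s + t}.
Proof.
by move=> s t; rewrite /trivext_module_scale trivext_DE scalerDl actDl addrACA.
Qed.
HB.instance Definition _ := GRing.Zmodule_isLmodule.Build S trivext_module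
  trivext_module_scaleA trivext_module_scale1 trivext_module_scaleDr
  trivext_module_scaleDl.

Fact trivext_module_out_linear : linear (fun x : restr trivext_module => x : X).
Proof.
by move=> a x y; rewrite -[LHS]/(a *: (x : X) + act 0 x + y) act0 addr0.
Qed.
Definition trivext_module_out : {linear restr trivext_module -> X} :=
  mk_linear trivext_module_out_linear.

Fact trivext_module_in_linear : linear (fun x : X => x : restr trivext_module).
Proof. by move=> a x y; rewrite -[RHS]/(a *: x + act 0 x + y) act0 addr0. Qed.
Definition trivext_module_in : {linear X -> restr trivext_module} :=
  mk_linear trivext_module_in_linear.

Lemma trivext_module_mact m (x : restr trivext_module) :
  mact m x = trivext_module_in (act m (trivext_module_out x)).
Proof. by rewrite /mact -[LHS]/(0 *: (x : X) + act m x) scale0r add0r. Qed.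

End Construction.

(** ** The coinduced module Hom_R(S, N) *)

Section Coinduction.
Variable N : lmodType R.

(** A linear map S -> N is a value x at 1 together with a restriction h to M.
    As M has square zero in S, the element m sends (x, h) to (h m, 0). *)
Let act (m : M) (y : N * homM M N) : N * homM M N := (y.2 m, 0).

Fact coind_balanced : balanced act.
Proof.
split=> [m n y|m y z|m a y]; rewrite /act /=; congr pair; rewrite ?addr0//.
exact: linearD.
Qed.
Fact coind_actZ a m y : act (a *: m) y = a *: act m y.
Proof. by rewrite /act; congr pair; rewrite ?scaler0// linearZ. Qed.
Fact coind_act2 m m' y : act m (act m' y) = 0.
Proof. by []. Qed.

Definition coind : lmodType S :=
  trivext_module coind_balanced coind_actZ coind_act2.

Definition coind_pr : {linear restr coind -> N} :=
  fst \o trivext_module_out coind_balanced coind_actZ coind_act2.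
Definition coind_hom : {linear restr coind -> homM M N} :=
  snd \o trivext_module_out coind_balanced coind_actZ coind_act2.
Definition coind_mk : {linear (N * homM M N)%type -> restr coind} :=
  trivext_module_in coind_balanced coind_actZ coind_act2.

Lemma coind_prK y : coind_pr (coind_mk y) = y.1. Proof. by []. Qed.
Lemma coind_homK y : coind_hom (coind_mk y) = y.2. Proof. by []. Qed.
Lemma coind_eq (x y : restr coind) :
  coind_pr x = coind_pr y -> coind_hom x = coind_hom y -> x = y.
Proof. by case: x y => ? ? [? ?] /= -> ->. Qed.

Lemma coind_pr_mact m (y : restr coind) : coind_pr (mact m y) = coind_hom y m.
Proof. by rewrite trivext_module_mact. Qed.
Lemma coind_hom_mact m (y : restr coind) : coind_hom (mact m y) = 0.
Proof. by rewrite trivext_module_mact. Qed.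

Variables (X : lmodType S) (f : {linear restr X -> N}).

Let coind_lift_restr : {linear restr X -> restr coind} :=
  coind_mk \o pairl f (homM_map M f \o beta X).

Fact coind_lift_mact m x :
  coind_lift_restr (mact m x) = mact m (coind_lift_restr x).
Proof.
apply: coind_eq.
  by rewrite coind_pr_mact coind_prK coind_homK.
rewrite coind_hom_mact coind_homK; apply: linear_ext => m'.
by rewrite -[LHS]/(f (mact m' (mact m x))) mact_mact linear0.
Qed.
Definition coind_lift : {linear X -> coind} := trivext_linear coind_lift_mact.

Lemma coind_pr_lift x : coind_pr (coind_lift x) = f x. Proof. by []. Qed.
Lemma coind_hom_lift x m : coind_hom (coind_lift x) m = f (mact m x).
Proof. by []. Qed.

End Coinduction.

Definition coind_map A B (f : {linear A -> B}) : {linear coind A -> coind B} :=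
  coind_lift (f \o coind_pr A).

Lemma coind_pr_map A B (f : {linear A -> B}) x :
  coind_pr B (coind_map f x) = f (coind_pr A x).
Proof. by []. Qed.
Lemma coind_hom_map A B (f : {linear A -> B}) x m :
  coind_hom B (coind_map f x) m = f (coind_hom A x m).
Proof. by rewrite coind_hom_lift -coind_pr_mact. Qed.

(** ** The induced module S (x)_R N *)

Section Induction.
Variable N : lmodType R.

Let act (m : M) (y : N * tensor M N) : N * tensor M N := (0, tens m y.1).

Fact ind_balanced : balanced act.
Proof.
split=> [m n y|m y z|m a y]; rewrite /act /=; congr pair; rewrite ?addr0//.
- exact: tensDl.
- exact: tensDr.
- exact: tensZ.
Qed.
Fact ind_actZ a m y : act (a *: m) y = a *: act m y.
Proof. by rewrite /act; congr pair; rewrite ?scaler0 ?tensZl. Qed.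
Fact ind_act2 m m' y : act m (act m' y) = 0.
Proof.
congr pair; rewrite /= -(scale0r 0) -tensZ rscale0r -(scale0r 0) -tensZl.
by rewrite scale0r.
Qed.

Definition ind : lmodType S := trivext_module ind_balanced ind_actZ ind_act2.

Definition ind_in1 : {linear N -> restr ind} :=
  trivext_module_in ind_balanced ind_actZ ind_act2 \o pairl idfun \0.
Definition ind_in2 : {linear tensor M N -> restr ind} :=
  trivext_module_in ind_balanced ind_actZ ind_act2 \o pairl \0 idfun.
Definition ind_pr1 : {linear restr ind -> N} :=
  fst \o trivext_module_out ind_balanced ind_actZ ind_act2.
Definition ind_pr2 : {linear restr ind -> tensor M N} :=
  snd \o trivext_module_out ind_balanced ind_actZ ind_act2.

Lemma ind_pr1_in1 x : ind_pr1 (ind_in1 x) = x. Proof. by []. Qed.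
Lemma ind_pr1_in2 t : ind_pr1 (ind_in2 t) = 0. Proof. by []. Qed.
Lemma ind_pr2_in1 x : ind_pr2 (ind_in1 x) = 0. Proof. by []. Qed.
Lemma ind_pr2_in2 t : ind_pr2 (ind_in2 t) = t. Proof. by []. Qed.
Lemma ind_pr1D x t : ind_pr1 (ind_in1 x + ind_in2 t) = x.
Proof. exact: addr0. Qed.
Lemma ind_pr2D x t : ind_pr2 (ind_in1 x + ind_in2 t) = t.
Proof. exact: add0r. Qed.
Lemma ind_decomp y : y = ind_in1 (ind_pr1 y) + ind_in2 (ind_pr2 y).
Proof.
case: y => x t; rewrite -[RHS]/((x + 0, 0 + t) : N * tensor M N).
by rewrite addr0 add0r.
Qed.

Lemma ind_mact m (y : restr ind) : mact m y = ind_in2 (tens m (ind_pr1 y)).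
Proof. by rewrite trivext_module_mact. Qed.

Lemma alpha_in1 t : alpha ind (tensor_map M ind_in1 t) = ind_in2 t.
Proof.
elim/tensor_ind: t => [|s t hs ht|m x]; first by rewrite !linear0.
  by rewrite !linearB hs ht.
by rewrite tensor_mapE alphaE ind_mact ind_pr1_in1.
Qed.

Variables (Y : lmodType S) (f : {linear N -> restr Y}).

Let ind_lift_restr : {linear restr ind -> restr Y} :=
  (f \o ind_pr1) \+ (alpha Y \o tensor_map M f \o ind_pr2).

Fact ind_lift_mact m y : ind_lift_restr (mact m y) = mact m (ind_lift_restr y).
Proof.
have liftE z : ind_lift_restr z =
    f (ind_pr1 z) + alpha Y (tensor_map M f (ind_pr2 z)) by [].
rewrite !liftE mactDr mact_alpha addr0 ind_mact ind_pr1_in2 linear0 add0r.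
by rewrite ind_pr2_in2 tensor_mapE alphaE.
Qed.
Definition ind_lift : {linear ind -> Y} := trivext_linear ind_lift_mact.

Lemma ind_liftE y :
  ind_lift y = f (ind_pr1 y) + alpha Y (tensor_map M f (ind_pr2 y)).
Proof. by []. Qed.

Lemma ind_lift_in1 x : ind_lift (ind_in1 x) = f x.
Proof. by rewrite ind_liftE ind_pr1_in1 ind_pr2_in1 !linear0 addr0. Qed.

Lemma ind_lift_unique (g : {linear ind -> Y}) :
  (forall x, g (ind_in1 x) = f x) -> forall y, g y = ind_lift y.
Proof.
move=> gE y; rewrite [y in g y]ind_decomp -alpha_in1 ind_liftE.
have -> : g (ind_in1 (ind_pr1 y)
  + alpha ind (tensor_map M ind_in1 (ind_pr2 y))) =
  g (ind_in1 (ind_pr1 y)) + g (alpha ind (tensor_map M ind_in1 (ind_pr2 y))).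
  exact: (linearD g).
rewrite gE alpha_map -(tensor_map_comp (h := f))// => x.
by rewrite restr_mapE gE.
Qed.

End Induction.

Definition ind_map A B (f : {linear A -> B}) : {linear ind A -> ind B} :=
  ind_lift (ind_in1 B \o f).

Lemma ind_mapE A B (f : {linear A -> B}) y :
  ind_map f y = ind_in1 B (f (ind_pr1 A y)) +
                ind_in2 B (tensor_map M f (ind_pr2 A y)).
Proof.
rewrite /ind_map ind_liftE -[X in X + _]/(ind_in1 B (f (ind_pr1 A y))).
by rewrite (tensor_map_comp (f := f) (g := ind_in1 B))// alpha_in1.
Qed.

Lemma ind_pr1_map A B (f : {linear A -> B}) y :
  ind_pr1 B (ind_map f y) = f (ind_pr1 A y).
Proof. by rewrite ind_mapE ind_pr1D. Qed.
Lemma ind_pr2_map A B (f : {linear A -> B}) y :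
  ind_pr2 B (ind_map f y) = tensor_map M f (ind_pr2 A y).
Proof. by rewrite ind_mapE ind_pr2D. Qed.

Lemma ind_eq N (x y : ind N) :
  ind_pr1 N x = ind_pr1 N y -> ind_pr2 N x = ind_pr2 N y -> x = y.
Proof. by move=> e1 e2; rewrite (ind_decomp x) (ind_decomp y) e1 e2. Qed.

(** ** Exactness of coinduction and induction *)

(** Surjectivity on the second component is the lifting of maps M -> C to B. *)
Lemma coind_ses A B C (f : {linear A -> B}) (g : {linear B -> C}) :
  Ext_vanishes 1 M A -> short_exact f g ->
  short_exact (coind_map f) (coind_map g).
Proof.
move=> vA fg; have [fi fgE gs] := fg; split=> [|x|y].
- move=> x y exy; apply: coind_eq.
    by apply: fi; rewrite -!coind_pr_map exy.
  by apply: linear_ext => m; apply: fi; rewrite -!coind_hom_map exy.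
- split=> [x0|[w <-]].
    have /fgE[a aE] : g (coind_pr B x) = 0.
      by rewrite -coind_pr_map x0 (linear0 (coind_pr C)).
    have [|h hE] := @lift_through_inj _ _ _ _ f (coind_hom B x) fi.
      move=> m; apply/fgE; rewrite -coind_hom_map x0.
      by rewrite (linear0 (coind_hom C)).
    exists (coind_mk A (a, h)); apply: coind_eq; first by rewrite coind_pr_map.
    by apply: linear_ext => m; rewrite coind_hom_map coind_homK.
  apply: coind_eq; first by rewrite !coind_pr_map (ses_gf _ fg) linear0.
  apply: linear_ext => m; rewrite !coind_hom_map (ses_gf _ fg).
  by rewrite (linear0 (coind_hom C)).
- have [h hE] := Ext1_lift (coind_hom C y) vA fg.
  have [b bE] := gs (coind_pr C y).
  exists (coind_mk B (b, h)); apply: coind_eq; first by rewrite coind_pr_map.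
  by apply: linear_ext => m; rewrite coind_hom_map coind_homK.
Qed.

Lemma ind_map_surj A B (f : {linear A -> B}) : surj f -> surj (ind_map f).
Proof.
move=> fs y; have [x xE] := fs (ind_pr1 B y).
have [t tE] := tensor_map_surj (M := M) fs (ind_pr2 B y).
exists (ind_in1 A x + ind_in2 A t); apply: ind_eq.
  by rewrite ind_pr1_map ind_pr1D.
by rewrite ind_pr2_map ind_pr2D.
Qed.

Lemma ind_ses A B C (f : {linear A -> B}) (g : {linear B -> C}) :
  Tor_vanishes 1 M C -> short_exact f g -> short_exact (ind_map f) (ind_map g).
Proof.
move=> vC fg; have [fi fgE gs] := fg; have Tfg := tensor_ses vC fg.
have [Tfi TfgE Tgs] := Tfg; split=> [x y|x|]; last exact: ind_map_surj.
- move=> exy; apply: ind_eq; first by apply: fi; rewrite -!ind_pr1_map exy.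
  by apply: Tfi; rewrite -!ind_pr2_map exy.
- split=> [x0|[y <-]]; last first.
    apply: ind_eq; first by rewrite !ind_pr1_map (ses_gf _ fg)
      (linear0 (ind_pr1 C)).
    by rewrite !ind_pr2_map (ses_gf _ Tfg) (linear0 (ind_pr2 C)).
  have /fgE[a aE] : g (ind_pr1 B x) = 0.
    by rewrite -ind_pr1_map x0 (linear0 (ind_pr1 C)).
  have /TfgE[t tE] : tensor_map M g (ind_pr2 B x) = 0.
    by rewrite -ind_pr2_map x0 (linear0 (ind_pr2 C)).
  exists (ind_in1 A a + ind_in2 A t); apply: ind_eq.
    by rewrite ind_pr1_map ind_pr1D.
  by rewrite ind_pr2_map ind_pr2D.
Qed.

(** Lift along the adjunction: maps from ind N are the R-linear maps from N. *)
Lemma ind_projective N : projective N -> projective (ind N).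
Proof.
move=> Np U V f g fs.
have [h hE] := Np _ _ (restr_map f) (restr_map g \o ind_in1 N) fs.
have fgE := ind_lift_unique (f := restr_map g \o ind_in1 N).
exists (ind_lift h) => y; rewrite [RHS]fgE//.
by apply: (fgE (f \o ind_lift h)) => x /=; rewrite ind_lift_in1 hE.
Qed.

End TrivextModules.

(** * Direct sums of copies of a module *)

Section DirectSum.
Variables (R : pzRingType) (I : eqType) (A : lmodType R).

Definition fin_supp : {pred I -> A} :=
  fun f => `[< exists s : seq I, forall i, i \notin s -> f i = 0 >].

Lemma fin_supp_submod : submod_closed fin_supp.
Proof.
split=> [|a f g /asboolP[s fs] /asboolP[t gt]]; apply/asboolP;
  first by exists [::].
exists (s ++ t) => i; rewrite mem_cat negb_or => /andP[/fs fi /gt gi].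
by rewrite -[LHS]/(a *: f i + g i) fi gi scaler0 addr0.
Qed.
HB.instance Definition _ :=
  GRing.isSubmodClosed.Build R (I -> A) fin_supp fin_supp_submod.

Record dsum := Dsum { dsum_val :> I -> A; _ : fin_supp dsum_val }.
HB.instance Definition _ := [isSub for dsum_val].
HB.instance Definition _ := [Choice of dsum by <:].
HB.instance Definition _ := [SubChoice_isSubZmodule of dsum by <:].
HB.instance Definition _ := [SubZmodule_isSubLmodule of dsum by <:].

Lemma dsum_eq (x y : dsum) : (forall i, x i = y i) -> x = y.
Proof. by move=> xy; apply: val_inj; apply: funext. Qed.

Lemma dsum_ZDE a (x y : dsum) i : (a *: x + y) i = a *: x i + y i.
Proof. by []. Qed.

Lemma dsum_supp (x : dsum) :
  {s : seq I | uniq s & forall i, i \notin s -> x i = 0}.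
Proof.
have [s xs] := cid (asboolP _ (valP x)).
by exists (undup s) => [|i]; rewrite ?undup_uniq// mem_undup => /xs.
Qed.

Fact dsum_in_subproof i a : fin_supp (fun j => if j == i then a else 0).
Proof. by apply/asboolP; exists [:: i] => j; rewrite inE => /negPf->. Qed.
Fact dsum_in_linear i : linear (fun a => Dsum (dsum_in_subproof i a)).
Proof.
move=> c a b; apply: dsum_eq => j; rewrite dsum_ZDE /=.
by case: eqP => // _; rewrite scaler0 addr0.
Qed.
Definition dsum_in i : {linear A -> dsum} := mk_linear (dsum_in_linear i).

Lemma dsum_inE i a j : dsum_in i a j = if j == i then a else 0.
Proof. by []. Qed.

Lemma big_supp_eq (V : zmodType) (s t : seq I) (F : I -> V) :
  uniq s -> uniq t ->
  (forall i, i \notin s -> F i = 0) -> (forall i, i \notin t -> F i = 0) ->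
  \sum_(i <- s) F i = \sum_(i <- t) F i.
Proof.
move=> us ut Fs Ft.
have rm r : \sum_(i <- r) F i = \sum_(i <- r | F i != 0) F i.
  by rewrite [RHS]big_rmcond// => i /negPn/eqP.
rewrite !rm -big_filter -[RHS]big_filter; apply: perm_big.
apply: uniq_perm => [||i]; rewrite ?filter_uniq// !mem_filter.
case: eqP => //= Fi.
by case: (boolP (i \in s)) => [_|/Fs//]; case: (boolP (i \in t)) => [_|/Ft].
Qed.

Section Lift.
Variables (V : lmodType R) (g : I -> {linear A -> V}).

Let lift (x : dsum) : V := \sum_(i <- s2val (dsum_supp x)) g i (x i).

Let liftE (x : dsum) s : uniq s -> (forall i, i \notin s -> x i = 0) ->
  lift x = \sum_(i <- s) g i (x i).
Proof.
move=> us xs; rewrite /lift; case: (dsum_supp x) => t ut xt /=.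
by apply: big_supp_eq => // i; [move/xt-> | move/xs->]; rewrite linear0.
Qed.

Fact dsum_lift_linear : linear lift.
Proof.
move=> a x y.
have [s us xs] := dsum_supp x; have [t ut yt] := dsum_supp y.
pose r := undup (s ++ t); have ur : uniq r by exact: undup_uniq.
have xr i : i \notin r -> x i = 0.
  by rewrite mem_undup mem_cat negb_or => /andP[/xs].
have yr i : i \notin r -> y i = 0.
  by rewrite mem_undup mem_cat negb_or => /andP[_ /yt].
rewrite !(@liftE _ r)// => [|i ir]; last first.
  by rewrite dsum_ZDE xr// yr// scaler0 addr0.
rewrite scaler_sumr -big_split; apply: eq_bigr => i _.
by rewrite dsum_ZDE linearP.
Qed.
Definition dsum_lift : {linear dsum -> V} := mk_linear dsum_lift_linear.

Lemma dsum_lift_in i a : dsum_lift (dsum_in i a) = g i a.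
Proof.
rewrite -[LHS]/(lift _) (@liftE _ [:: i])//.
  by rewrite big_seq1 dsum_inE eqxx.
by move=> j; rewrite inE dsum_inE => /negPf->.
Qed.

End Lift.

Lemma dsum_ext (V : lmodType R) (f g : {linear dsum -> V}) :
  (forall i a, f (dsum_in i a) = g (dsum_in i a)) -> f =1 g.
Proof.
move=> fg x; have [s us xs] := dsum_supp x.
have -> : x = \sum_(i <- s) dsum_in i (x i).
  apply: dsum_eq => j.
  have -> : (\sum_(i <- s) dsum_in i (x i)) j = \sum_(i <- s) dsum_in i (x i) j.
    by elim/big_rec2: _ => // i u v _ <-.
  have [js|js] := boolP (j \in s); last first.
    rewrite xs// big_seq big1// => i is_; rewrite dsum_inE; case: eqP => // ji.
    by rewrite ji is_ in js.
  rewrite (bigD1_seq j)//= eqxx big1 ?addr0// => i ij.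
  by rewrite eq_sym (negPf ij).
by rewrite !linear_sum; apply: eq_bigr => i _; exact: fg.
Qed.

End DirectSum.
Arguments dsum_in {R I A} i.

Section DirectSumExt.
Variables (R : pzRingType) (I : eqType).
Implicit Types A B C K P : lmodType R.

Lemma dsum_projective P : projective P -> projective (dsum I P).
Proof.
move=> Pp U V f g fs.
have /choice[h hE] i :
    exists h : {linear P -> U}, forall x, f (h x) = g (dsum_in i x).
  exact: Pp _ _ f (g \o dsum_in i) fs.
exists (dsum_lift h); apply: (dsum_ext (f := f \o dsum_lift h)) => i a /=.
by rewrite dsum_lift_in hE.
Qed.

Fact dsum_map_subproof A B (f : {linear A -> B}) (x : dsum I A) :
  fin_supp (f \o x).
Proof.
have [s _ xs] := dsum_supp x; apply/asboolP; exists s => i /xs /= ->.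
exact: linear0.
Qed.
Fact dsum_map_linear A B (f : {linear A -> B}) :
  linear (fun x => Dsum (dsum_map_subproof f x)).
Proof. by move=> a x y; apply: dsum_eq => i; rewrite /= linearP. Qed.
Definition dsum_map A B (f : {linear A -> B}) : {linear dsum I A -> dsum I B} :=
  mk_linear (dsum_map_linear f).

Lemma dsum_mapE A B (f : {linear A -> B}) x i : dsum_map f x i = f (x i).
Proof. by []. Qed.

Lemma dsum_map_in A B (f : {linear A -> B}) i a :
  dsum_map f (dsum_in i a) = dsum_in i (f a).
Proof.
apply: dsum_eq => j; rewrite dsum_mapE !dsum_inE.
by case: eqP => // _; exact: linear0.
Qed.

Lemma dsum_ses A B C (f : {linear A -> B}) (g : {linear B -> C}) :
  short_exact f g -> short_exact (dsum_map f) (dsum_map g).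
Proof.
move=> fg; have [fi fgE gs] := fg; split=> [x y fxy|x|x].
- by apply: dsum_eq => i; apply: fi; rewrite -!dsum_mapE fxy.
- split=> [gx0|[y <-]]; last first.
    by apply: dsum_eq => i; rewrite !dsum_mapE (ses_gf _ fg).
  have /choice[y yE] i : exists a, f a = x i.
    by apply/fgE; rewrite -dsum_mapE gx0.
  have ys : fin_supp y.
    have [s _ xs] := dsum_supp x; apply/asboolP; exists s => i /xs xi.
    by apply: (linear_inj0 fi); rewrite yE.
  by exists (Dsum ys); apply: dsum_eq.
- have [h hE] := choice gs; have [s _ xs] := dsum_supp x.
  have ys : fin_supp (fun i => if i \in s then h (x i) else 0).
    by apply/asboolP; exists s => i /negPf->.
  exists (Dsum ys); apply: dsum_eq => i; rewrite dsum_mapE /=.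
  by case: ifPn => [_|/xs->]; rewrite ?hE ?linear0.
Qed.

(** A direct sum of projective covers is a projective cover of the direct sum,
    whose kernel is the direct sum of the kernels. *)
Lemma acyclic_dsum D i A : acyclic (@extends R D) i A ->
  acyclic (@extends R D) i (dsum I A).
Proof.
elim: i A => [|i IH] A hA;
    have [P [K [k [p [Pp kp]]]]] := projective_cover_ses A.
  apply: (acyclic0_cover (extends_stable D) (dsum_projective Pp) (dsum_ses kp)).
  move=> phi; have /choice[psi psiE] j : exists h : {linear P -> D},
      forall x, h (k x) = phi (dsum_in j x).
    exact: hA _ _ _ _ kp (phi \o dsum_in j).
  exists (dsum_lift psi) => x.
  apply: (dsum_ext (f := dsum_lift psi \o dsum_map k)) => j a /=.
  by rewrite dsum_map_in dsum_lift_in psiE.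
apply: (acyclic_quot (extends_stable D) (dsum_ses kp)).
  by apply: IH; exact: hA Pp kp.
by apply: acyclic_projective; [exact: extends_stable|exact: dsum_projective].
Qed.

Lemma regular_projective : projective (R^o : lmodType R).
Proof.
move=> U V f g fs; have [u uE] := fs (g 1).
have hL : linear (fun a : R^o => a *: u).
  by move=> c a b; rewrite scalerDl scalerA.
exists (mk_linear hL) => a; rewrite -[LHS]/(f (a *: u)) linearZ /= uE -linearZ.
by congr (g _); exact: mulr1.
Qed.

End DirectSumExt.

(** ** Projective modules over the trivial extension, seen over R *)

Section RestrProjective.
Variables (R : pzRingType) (M : bimodType R).
Notation S := (trivext M).

Lemma restr_dsum I (X : lmodType S) :
  isomorphic (dsum I (restr X)) (restr (dsum I X)).
Proof.
have ok (x : dsum I (restr X)) : fin_supp (dsum_val x : I -> X).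
  exact: (valP x).
have fL : linear (fun x => Dsum (ok x) : restr (dsum I X)).
  by move=> a x y; apply: val_inj.
have ok' (x : restr (dsum I X)) : fin_supp (dsum_val x : I -> restr X).
  exact: (valP (x : dsum I X)).
exists (mk_linear fL); exists (fun x => Dsum (ok' x)) => x; exact: val_inj.
Qed.

Lemma restr_regular_ses : exists (f : {linear M -> restr (S^o : lmodType S)})
  (g : {linear restr (S^o : lmodType S) -> R^o}), short_exact f g.
Proof.
have fL : linear (fun m => (0, m) : restr (S^o : lmodType S)).
  move=> a m n; congr pair => /=; first by rewrite mulr0 addr0.
  by rewrite rscale0r addr0.
have gL : linear (fun x : restr (S^o : lmodType S) => x.1 : R^o) by [].
exists (mk_linear fL), (mk_linear gL); split=> [m n [] //|[a m]|a];
  last by exists (a, 0).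
split=> [a0|[n <-]//]; exists m; congr pair.
exact/esym/a0.
Qed.

(** [P] is a direct summand of a direct sum of copies of S, and over R the
    module S is an extension of R by M. *)
Lemma acyclic_restr_projective D i (P : lmodType S) :
  projective P -> Ext_vanishes i.+1 M D -> acyclic (@extends R D) i (restr P).
Proof.
move=> Pp /Ext_acyclic vM; have st := extends_stable D.
have gL (x : P) : linear (fun s : S^o => s *: x).
  by move=> c a b; rewrite scalerDl scalerA.
pose q : {linear dsum P S^o -> P} := dsum_lift (fun x => mk_linear (gL x)).
have qs : surj q.
  by move=> x; exists (@dsum_in S P S^o x (1 : S)); rewrite dsum_lift_in;
    exact: scale1r.
have [s sE] := projective_split Pp qs.
apply: (acyclic_retract st (s := restr_map s) (r := restr_map q)) => //.
apply: (acyclic_iso (restr_dsum _ _)); apply: acyclic_dsum.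
have [f [g fg]] := restr_regular_ses; apply: (acyclic_extension st fg) => //.
by apply: acyclic_projective => //; exact: regular_projective.
Qed.

End RestrProjective.

(** * The left cotorsion pair *)

Section Coinduced.
Variables (R : pzRingType) (M : bimodType R).
Notation S := (trivext M).
Implicit Types X Y Z : lmodType S.
Implicit Types N G F : lmodType R.

(** Membership in [classJ] read on elements: [N] is the submodule of [Y] killed
    by [M], and every linear map from [M] to [N] is the action of [M] on some
    element of [Y]. *)
Definition coinduced_on Y N (i : {linear N -> restr Y}) :=
  [/\ injective i,
      forall y : restr Y, (forall m, mact m y = 0) <-> exists x, i x = y &
      forall h : homM M N, exists y : restr Y, forall m, mact m y = i (h m)].

Lemma coinduced_on_mact Y N (i : {linear N -> restr Y}) m x :
  coinduced_on i -> mact m (i x) = 0.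
Proof. by case=> _ iE _; apply: (iE (i x)).2; exists x. Qed.

Lemma coinduced_on_unique Y N N' (i : {linear N -> restr Y})
    (i' : {linear N' -> restr Y}) :
  coinduced_on i -> coinduced_on i' -> isomorphic N N'.
Proof.
move=> [ii iE _] [ii' iE' _].
have [|f fE] := @lift_through_inj _ _ _ _ i' i ii'.
  by move=> x; apply/iE'/iE; exists x.
exists f; apply: inj_surj_bij.
  by apply: linear_inj => x fx0; apply: (linear_inj0 ii);
    rewrite -fE fx0 linear0.
move=> y; have /iE[x xE] : forall m, mact m (i' y) = 0 by apply/iE'; exists y.
by exists x; apply: ii'; rewrite fE.
Qed.

Lemma coinduced_on_iso X Y N (f : {linear X -> Y}) (i : {linear N -> restr X}) :
  bijective f -> coinduced_on i -> coinduced_on (restr_map f \o i).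
Proof.
move=> fb ci; have [ii iE iH] := ci; have fi := bij_inj fb;
  have [f' fK f'K] := fb.
split=> [|y|h]; first exact: inj_comp fi ii.
- split=> [y0|[x <-] m].
    have /iE[x xE] : forall m, mact m (f' y : restr X) = 0.
      move=> m; apply: fi; rewrite (linear0 f) mact_map f'K; exact: y0.
    by exists x; rewrite /= xE restr_mapE f'K.
  by rewrite /= restr_mapE -mact_map (coinduced_on_mact _ _ ci) (linear0 f).
- have [y yE] := iH h; exists (f y) => m.
  by rewrite -mact_map yE.
Qed.

Lemma coinduced_on_prod Y Y' N N' (i : {linear N -> restr Y})
    (i' : {linear N' -> restr Y'}) : coinduced_on i -> coinduced_on i' ->
  exists j : {linear (N * N')%type -> restr (Y * Y')%type}, coinduced_on j.
Proof.
move=> ci ci'; have [ii iE iH] := ci; have [ii' iE' iH'] := ci'.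
have jL : linear (fun x : N * N' => (i x.1, i' x.2) : restr (Y * Y')%type).
  by move=> a x y; rewrite !linearP.
exists (mk_linear jL); split=> [[x x'] [y y'] [/ii -> /ii' ->] //|[y y']|h].
- split=> [y0|[[x x'] [<- <-]] m]; last first.
    congr pair; first exact: (coinduced_on_mact m x ci).
    exact: (coinduced_on_mact m x' ci').
  have /iE[x xE] : forall m, mact m (y : restr Y) = 0.
    by move=> m; exact: (congr1 fst (y0 m)).
  have /iE'[x' xE'] : forall m, mact m (y' : restr Y') = 0.
    by move=> m; exact: (congr1 snd (y0 m)).
  by exists (x, x'); rewrite -xE -xE'.
- have [y yE] := iH (fst \o h); have [y' yE'] := iH' (snd \o h).
  exists (y, y') => m; congr pair; [exact: yE | exact: yE'].
Qed.

Lemma classJP (D : modclass R) Y : is_class D ->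
  classJ M D Y <-> exists N (i : {linear N -> restr Y}), D N /\ coinduced_on i.
Proof.
move=> [D0 DI]; split=> [[DN be]|[N [i [DN ci]]]].
  exists (ker (beta Y)), \val; split=> //.
  have [vi vE] := ker_exact (beta Y); split=> // [y|h].
    rewrite -vE; split=> [y0|/(congr1 (fun u : homM M _ => u _)) by0 m].
      by apply: linear_ext => m; exact: y0.
    by rewrite -betaE by0.
  pose u : homM M (restr Y) := (\val : {linear ker (beta Y) -> _}) \o h.
  have /be[y yE] : homM_map M (beta Y) u = 0.
    by apply: linear_ext => m; apply/vE; exists (h m).
  by exists y => m; rewrite -betaE yE.
have [ii iE iH] := ci.
have bE (y : restr Y) : beta Y y = 0 <-> exists x, i x = y.
  rewrite -iE; split=> [by0 m|y0]; first by rewrite -betaE by0.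
  by apply: linear_ext => m; exact: y0.
split; last first.
  move=> u; split=> [u0|[y <-]]; last first.
    by apply: linear_ext => m; apply: linear_ext => m'; exact: mact_mact.
  have [|h hE] := @lift_through_inj _ _ _ _ i u ii.
    move=> m; apply/bE; exact: (congr1 (fun v : homM M (homM M _) => v m) u0).
  have [y yE] := iH h; exists y; apply: linear_ext => m.
  by rewrite betaE yE hE.
have be0 x : beta Y (i x) = 0 by apply/bE; exists x.
apply: DI DN; exists (to_ker be0).
apply: inj_surj_bij => [x y /(congr1 val)/ii//|].
by apply: to_ker_surj => y; exact: bE.
Qed.

Lemma coind_coinduced N : coinduced_on (coind_mk M N \o pairl idfun \0).
Proof.
split=> [x y [] //|y|h].
- split=> [y0|[x <-] m]; last first.
    by apply: coind_eq; rewrite ?coind_pr_mact ?coind_hom_mact linear0.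
  exists (coind_pr M N y); apply: coind_eq => //; apply: linear_ext => m.
  by rewrite -[RHS]coind_pr_mact y0 linear0.
- exists (coind_mk M N (0, h)) => m; apply: coind_eq.
    by rewrite coind_pr_mact.
  by rewrite coind_hom_mact.
Qed.

Lemma classJ_coind (D : modclass R) N : is_class D -> D N ->
  classJ M D (coind M N).
Proof.
by move=> Dc DN; apply/classJP => //;
  exists N, (coind_mk M N \o pairl idfun \0);
   split=> //; exact: coind_coinduced.
Qed.

Lemma classJ_is_class (D : modclass R) : is_class D -> is_class (classJ M D).
Proof.
move=> Dc; have [D0 _] := Dc; split=> [Y Y0|X Y [f fb]].
  apply/classJP => //; exists (zero_obj R), \0; split; first exact/D0/zero_objP.
  split=> [x y _|y|h]; first by rewrite (zero_objP x) (zero_objP y).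
    split=> [_|_ m]; first by exists 0; rewrite linear0 (Y0 y).
    exact: Y0.
  by exists 0 => m; rewrite mact0r.
move=> /(classJP _ Dc)[N [i [DN ci]]]; apply/classJP => //.
by exists N, (restr_map f \o i); split=> //; exact: coinduced_on_iso.
Qed.

(** [Y] is an extension of Hom_R(M, N) by [N] as an [R]-module. It splits, and a
    retraction [Y -> N] induces the isomorphism with the coinduced module. *)
Lemma coinduced_on_coind Y N (i : {linear N -> restr Y}) :
  coinduced_on i -> Ext_vanishes 1 (homM M N) N -> isomorphic (coind M N) Y.
Proof.
move=> ci vN; have [ii iE iH] := ci; apply: isomorphic_sym.
have iHi : injective (homM_map M i).
  apply: linear_inj => u u0; apply: linear_ext => m; apply: (linear_inj0 ii).
  exact: (congr1 (fun v : homM M _ => v m) u0).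
have [|g gE] := @lift_through_inj _ _ _ _ (homM_map M i) (beta Y) iHi.
  move=> y; have [|h hE] := @lift_through_inj _ _ _ _ i (beta Y y) ii.
    by move=> m; apply/iE => m'; exact: mact_mact.
  by exists h; apply: linear_ext => m; exact: hE.
have gm y m : i (g y m) = mact m y.
  exact: (congr1 (fun v : homM M _ => v m) (gE y)).
have ig : short_exact i g.
  split=> // [y|h]; last first.
    have [y yE] := iH h; exists y; apply: iHi; rewrite gE.
    by apply: linear_ext => m; exact: yE.
  rewrite -iE; split=> [gy0 m|y0]; first by rewrite -gm gy0 linear0.
  by apply: linear_ext => m; apply: ii; rewrite gm y0 linear0.
have [s sE] := Ext1_split vN ig; have [r rE] := ses_split_r ig sE.
have rm y m : r (mact m y) = g y m by rewrite -gm rE.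
exists (coind_lift r); apply: inj_surj_bij.
  apply: linear_inj => y y0.
  have r0 : r y = 0 by rewrite -coind_pr_lift y0 (linear0 (coind_pr M N)).
  have /iE[x xE] : forall m, mact m (y : restr Y) = 0.
    move=> m; rewrite -gm -rm -coind_hom_lift y0.
    by rewrite (linear0 (coind_hom M N)) linear0.
  by rewrite -xE -[x]rE xE r0; exact: (linear0 i).
move=> z; have [y yE] := iH (coind_hom M N z).
have y'E : coind_lift r (y + i (coind_pr M N z - r y) : restr Y) = z.
  have ki x m : mact m (i x) = 0 by exact: coinduced_on_mact.
  apply: coind_eq.
    by rewrite coind_pr_lift linearD rE addrC subrK.
  apply: linear_ext => m; rewrite coind_hom_lift mactDr ki addr0 rm.
  by apply: ii; rewrite gm yE.
by exists (y + i (coind_pr M N z - r y)).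
Qed.

(** S-linear maps to the coinduced module are R-linear maps to [N]. A projective
    S-module P need not be projective over R, but Ext^(j+1)(P, N) vanishes
    together with Ext^(j+1)(M, N), which is what shifting the degree takes. *)
Lemma acyclic_coind i X N :
  (forall j, (j < i)%N -> Ext_vanishes j.+1 M N) ->
  acyclic (@extends R N) i (restr X) -> acyclic (@extends S (coind M N)) i X.
Proof.
elim: i X => [|i IH] X vM hX.
  move=> K X' k p kp g.
  have [h hE] := hX _ _ _ _ (restr_ses kp) (coind_pr M N \o restr_map g).
  exists (coind_lift h) => u; apply: coind_eq;
    first by rewrite coind_pr_lift hE.
  apply: linear_ext => m; rewrite coind_hom_lift -mact_map -restr_mapE hE /=.
  by rewrite -coind_pr_mact -mact_map.
move=> K P k p Pp kp; apply: IH => [j ji|]; first by apply: vM; exact: ltnW.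
apply: (acyclic_sub (extends_stable N) (restr_ses kp)) => //.
by apply: acyclic_restr_projective => //; exact: vM.
Qed.

(** ** Finite resolutions by coinduced modules *)

Variables (D : modclass R) (n : nat).
Hypotheses (n1 : (1 <= n)%N) (Dc : is_class D).
Hypothesis vM : forall i (B : lmodType R), (1 <= i <= n)%N -> D B ->
  Ext_vanishes i M B.

Lemma wedge_len_coind k F : (k < n)%N ->
  wedge_len D k F -> wedge_len (classJ M D) k (coind M F).
Proof.
elim: k F => [|k IH] F kn; first exact: classJ_coind.
move=> [K [B [f [g [fg DB wK]]]]].
exists (coind M K), (coind M B), (coind_map M f), (coind_map M g); split.
- by apply: coind_ses => //; apply: (Ext_wedge_len vM wK) => //; exact: ltnW.
- exact: classJ_coind.
- by apply: IH => //; exact: ltnW.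
Qed.

(** The proof is the nine lemma for the first step of the resolution,
    [Y' -> Y0 -> Y], and the extensions of Hom_R(M, _) by the submodule killed
    by [M]; the column Hom_R(M, _) is exact because Ext^1(M, N') = 0. *)
Lemma wedge_len_classJ k Y : (k < n)%N -> wedge_len (classJ M D) k Y ->
  exists N (i : {linear N -> restr Y}), wedge_len D k N /\ coinduced_on i.
Proof.
elim: k Y => [|k IH] Y kn; first by move/(classJP _ Dc).
move=> [Y' [Y0 [f [g [fg /(classJP _ Dc)[N0 [i0 [DN0 ci0]]]]]]]].
move=> /IH[|N' [i' [wN' ci']]]; first exact: ltnW.
have [ii' iE' iH'] := ci'; have [ii0 iE0 iH0] := ci0; have [fi fgE gs] := fg.
have [|u uE] := @lift_through_inj _ _ _ _ i0 (restr_map f \o i') ii0.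
  move=> x; apply/iE0 => m; rewrite /= restr_mapE -mact_map.
  by rewrite (coinduced_on_mact _ _ ci') (linear0 f).
have ui : injective u.
  apply: linear_inj => x u0; apply: (linear_inj0 ii'); apply: (linear_inj0 fi).
  by rewrite -[LHS]uE u0 linear0.
pose q := coker_proj u; have qs : surj q by exact: coker_proj_surj.
have uq : short_exact u q by split=> // x; exact: coker_proj_eq0.
have [|i iE] := @factor_through_surj _ _ _ _ q (restr_map g \o i0) qs.
  by move=> x /coker_proj_eq0[z <-]; rewrite /= uE /= !restr_mapE (ses_gf _ fg).
have giE x : i (q x) = g (i0 x) by exact: iE.
(* an element of Y0 that M sends into the image of f can be moved, along
   Y', to an element killed by M *)
have key (b : restr Y0) : (forall m, mact m (g b : restr Y) = 0) ->
    exists x, g (i0 x) = g b.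
  move=> gb0.
  have [|h hE] := @lift_through_inj _ _ _ _ (i0 \o u) (beta Y0 b)
    (inj_comp ii0 ui).
    move=> m; have /fgE[y' y'E] : g (mact m b) = 0 by rewrite mact_map gb0.
    have /iE'[x' x'E] : forall m', mact m' (y' : restr Y') = 0.
      move=> m'; apply: fi; rewrite mact_map y'E (linear0 f); exact: mact_mact.
    by exists x'; rewrite /= uE /= x'E.
  have [y' y'E] := iH' h.
  have /iE0[x xE] : forall m, mact m (b - restr_map f y') = 0.
    move=> m; rewrite mactBr -betaE -hE /= uE /= -y'E !restr_mapE mact_map.
    exact: subrr.
  exists x; rewrite xE -[LHS]/(restr_map g _) linearB !restr_mapE (ses_gf _ fg).
  exact: subr0.
exists (coker u), i; split.
  by exists N', N0, u, q.
split=> [|y|h].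
- apply: linear_inj => z; have [x <-] := qs z; rewrite giE => /fgE[y' y'E].
  have /iE'[x' x'E] : forall m, mact m (y' : restr Y') = 0.
    move=> m; apply: fi; rewrite mact_map y'E (linear0 f).
    exact: coinduced_on_mact.
  apply/coker_proj_eq0; exists x'; apply: ii0.
  by rewrite uE /= restr_mapE x'E y'E.
- split=> [y0|[z <-] m].
    by have [b bE] := gs y; have [|x xE] := key b; [rewrite bE|exists (q x);
      rewrite giE xE].
  have [x <-] := qs z; rewrite giE -mact_map (coinduced_on_mact _ _ ci0).
  exact: (linear0 g).
- have v1 : Ext_vanishes 1 M N' by apply: (Ext_wedge_len vM wN') => //;
    exact: ltnW.
  have [h0 h0E] := Ext1_lift h v1 uq; have [b bE] := iH0 h0.
  by exists (g b) => m; rewrite -mact_map bE -h0E giE.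
Qed.

Hypothesis Jext : closed_under_extensions (wedge (classJ M D) n.-1).

(** The closure under extensions, assumed over S, gives a resolution of the
    direct sum of two coinduced modules; it descends to the submodules killed
    by M. *)
Lemma wedge_len_prod F F' : wedge_len D n.-1 F -> wedge_len D n.-1 F' ->
  wedge_len D n.-1 (F * F')%type.
Proof.
move=> wF wF'; have Jc := classJ_is_class Dc.
have kn : (n.-1 < n)%N by rewrite prednK.
have wJ A : wedge_len D n.-1 A -> wedge (classJ M D) n.-1 (coind M A).
  by move=> wA; apply/wedgeP => //; exact: wedge_len_coind.
have := Jext (prod_ses (coind M F) (coind M F')) (wJ F wF) (wJ F' wF').
move=> /(wedgeP _ _ Jc)/(wedge_len_classJ kn)[N [i [wN ci]]].
apply: wedge_len_iso wN => //.
have [j cj] := coinduced_on_prod (coind_coinduced F) (coind_coinduced F').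
exact: coinduced_on_unique ci cj.
Qed.

(** Ext^1(Hom_R(M, F), F') = 0 for all F and F' with a finite resolution by D:
    apply the hypothesis to the direct sum of F and F', which again has one. *)
Hypothesis HF : forall F, wedge_len D n.-1 F -> Ext_vanishes 1 (homM M F) F.

Lemma Ext_homM_wedge F F' : wedge_len D n.-1 F -> wedge_len D n.-1 F' ->
  Ext_vanishes 1 (homM M F) F'.
Proof.
move=> wF wF'; have vFF := HF (wedge_len_prod wF wF').
pose i1 : {linear F -> (F * F')%type} := pairl idfun \0.
pose i2 : {linear F' -> (F * F')%type} := pairl \0 idfun.
apply: (Ext_covariant_retract (s := i2) (r := snd)) => //.
apply: (Ext_retract (s := homM_map M i1) (r := homM_map M fst)) vFF => u.
exact: linear_ext.
Qed.

Variable C : modclass R.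
Hypotheses (CD : left_cotorsion_pair n C D) (her : hereditary n C D).

(** The approximation K -> A -> Hom_R(M, F) splits. *)
Lemma homM_wedge F : wedge_len D n.-1 F -> C (homM M F).
Proof.
move=> wF; have [Cc _ Csum _ app] := CD.
have [K [A [f [g [fg CA]]]]] := app (homM M F) => /(wedgeP _ _ Dc) wK.
have [s sE] := Ext1_split (Ext_homM_wedge wF wK) fg.
exact: summand_quot Cc Csum fg sE CA.
Qed.

Lemma left_extension_closed (A B B' : lmodType R) (f : {linear A -> B})
    (g : {linear B -> B'}) :
  short_exact f g -> C A -> C B' -> C B.
Proof.
have [_ _ _ vCD _] := CD; move=> fg CA CB'.
apply: (left_cotorsion_orthogonal n1 CD) => -[//|i] N iN DN.
apply/Ext_acyclic; apply: (acyclic_extension (extends_stable N) fg);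
  by apply/Ext_acyclic; exact: vCD.
Qed.

(** [Y] is coinduced from some [N] in D, so that Ext over S from [X] to [Y]
    is controlled by Ext over R from [X] to [N]. *)
Lemma Ext_classU_classJ i X Y : (i <= n)%N -> classU M C X -> classJ M D Y ->
  Ext_vanishes i.+1 X Y.
Proof.
have [_ _ _ vCD _] := CD; move=> ilen CX /(classJP _ Dc)[N [j [DN cj]]].
have wN : wedge_len D n.-1 N.
  by elim: n.-1 => // k; exact: wedge_lenS.
have [f [f' fK f'K]] := coinduced_on_coind cj (HF wN).
have vX : Ext_vanishes i.+1 X (coind M N).
  apply/Ext_acyclic; apply: acyclic_coind => [k ki|].
    by apply: vM => //=; apply: leq_trans ki _.
  apply/Ext_acyclic; have [iltn|nlei] := ltnP i n; first exact: vCD.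
  have -> : i = n by apply/eqP; rewrite eqn_leq ilen.
  exact: her.
have [h hE] : exists h : {linear Y -> coind M N}, forall y, f (h y) = y.
  apply: (lift_through_inj (h := idfun)) => [|y]; first exact: can_inj fK.
  by exists (f' y); rewrite f'K.
exact: Ext_covariant_retract hE vX.
Qed.

(** Pull the coinduced approximation Hom_R(S, X0) -> Hom_R(S, A) back along
    the unit A -> Hom_R(S, A): the kernel is coinduced, and over R the
    pullback is an extension of X0 by Hom_R(M, K). *)
Lemma left_approximation (A : lmodType S) :
  exists (K X : lmodType S) (f : {linear K -> X}) (g : {linear X -> A}),
    [/\ short_exact f g, classU M C X & wedge (classJ M D) n.-1 K].
Proof.
have kn : (n.-1 < n)%N by rewrite prednK.
have [_ _ _ _ app] := CD.
have [K [X0 [k [p [kp CX0 /(wedgeP _ _ Dc) wK]]]]] := app (restr A).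
have [ki kpE ps] := kp.
have vK : Ext_vanishes 1 M K by apply: (Ext_wedge_len vM wK); rewrite // add1n.
have ckp := coind_ses vK kp.
pose eta : {linear A -> coind M (restr A)} :=
  coind_lift (idfun : {linear restr A -> restr A}).
have [W [p1 [p2 pb]]] := pullback_exists (coind_map M p) eta.
have [k' kW kE] := pullback_ses pb ckp; have [ki' kWE p2s] := kW.
exists (coind M K), W, k', p2; split=> //; last first.
  by apply/wedgeP; [exact: classJ_is_class | exact: wedge_len_coind].
pose incl : {linear homM M K -> restr W} :=
  restr_map k' \o coind_mk M K \o pairl \0 idfun.
pose pr : {linear restr W -> X0} := coind_pr M X0 \o restr_map p1.
apply: (left_extension_closed (f := incl) (g := pr)) => //;
  last exact: homM_wedge.
have [c e _] := pb.
have prk z : pr (k' z) = k (coind_pr M K z).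
  by rewrite -coind_pr_map -kE.
split=> [u v /ki'[]//|w|x].
- split=> [prw0|[u <-]]; last by rewrite prk linear0.
  have /kWE[z zE] : p2 w = 0.
    have /(congr1 (coind_pr M _)) := c w.
    rewrite coind_pr_map coind_pr_lift -[coind_pr M X0 _]/(pr w) prw0 linear0.
    exact: esym.
  exists (coind_hom M K z); rewrite -zE; congr (k' _).
  apply: coind_eq => //; apply: ki; rewrite -[RHS]prk zE prw0.
  exact: linear0.
- have [h hE] := Ext1_lift (beta A (p x)) vK kp.
  have [|w wE _] := e (coind_mk M X0 (x, h)) (p x).
    2: by exists w; rewrite /= wE.
  apply: coind_eq; first by rewrite coind_pr_map.
  by apply: linear_ext => m; rewrite coind_hom_map coind_homK hE.
Qed.

End Coinduced.

Lemma classU_is_class (R : pzRingType) (M : bimodType R) (C : modclass R) :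
  is_class C -> is_class (classU M C).
Proof.
move=> [C0 CI]; split=> [X X0|X Y [f [f' fK f'K]]]; first exact: C0.
by apply: CI; exists (restr_map f); exists f'.
Qed.

Lemma classU_summands (R : pzRingType) (M : bimodType R) (C : modclass R) :
  is_class C -> closed_under_summands C -> closed_under_summands (classU M C).
Proof.
move=> [_ CI] Csum X Y CXY; apply: (Csum (restr X) (restr Y)); apply: CI CXY.
have fL : linear (fun x : restr (X * Y)%type => (x : restr X * restr Y)) by [].
by exists (mk_linear fL); exists id.
Qed.


(** * The right cotorsion pair *)

Section Induced.
Variables (R : pzRingType) (M : bimodType R).
Notation S := (trivext M).
Implicit Types X Y Z : lmodType S.
Implicit Types N G E : lmodType R.

(** The dual of [coinduced_on]: [N] is the quotient of [X] by [M X], and the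
    action M (x) X -> X factors through an injection of M (x) N. *)
Definition induced_on X N (p : {linear restr X -> N}) :=
  [/\ surj p,
      forall x : restr X, p x = 0 <-> exists t, alpha X t = x &
      forall t, alpha X t = 0 -> tensor_map M p t = 0].

Lemma induced_on_alpha X N (p : {linear restr X -> N}) t :
  induced_on p -> p (alpha X t) = 0.
Proof. by case=> _ pE _; apply: (pE _).2; exists t. Qed.

Lemma induced_on_alpha0 X N (p : {linear restr X -> N}) t :
  induced_on p -> tensor_map M p t = 0 ->
  exists s, tensor_map M (alpha X) s = t.
Proof.
move=> [ps pE _] /(tensor_map_exact (f := alpha X) _ ps)[x|s <-];
  first exact: pE.
by exists s.
Qed.

Lemma induced_on_unique X N N' (p : {linear restr X -> N})
    (p' : {linear restr X -> N'}) :
  induced_on p -> induced_on p' -> isomorphic N N'.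
Proof.
move=> [ps pE _] [ps' pE' _].
have [|f fE] := @factor_through_surj _ _ _ _ p p' ps.
  by move=> x /pE/pE'.
exists f; apply: inj_surj_bij.
  apply: linear_inj => y; have [x <-] := ps y; rewrite fE => /pE' xM.
  exact/pE.
by move=> y; have [x <-] := ps' y; exists (p x).
Qed.

Lemma induced_on_iso X Y N (f : {linear Y -> X}) (p : {linear restr X -> N}) :
  bijective f -> induced_on p -> induced_on (p \o restr_map f).
Proof.
move=> fb [ps pE pT]; have fi := bij_inj fb; have [f' fK f'K] := fb.
have fs : surj (restr_map f) by move=> x; exists (f' x); exact: f'K.
split=> [z|y|t].
- by have [x <-] := ps z; have [y <-] := fs x; exists y.
- rewrite /= pE; split=> [[t tE]|[t <-]].
    have [s sE] := tensor_map_surj (M := M) fs t.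
    by exists s; apply: fi; rewrite alpha_map sE.
  by exists (tensor_map M (restr_map f) t); rewrite -alpha_map.
- move=> t0; rewrite (tensor_map_comp (f := restr_map f) (g := p))//.
  by apply: pT; rewrite -alpha_map t0; exact: (linear0 f).
Qed.

Lemma induced_on_prod X X' N N' (p : {linear restr X -> N})
    (p' : {linear restr X' -> N'}) : induced_on p -> induced_on p' ->
  exists q : {linear restr (X * X')%type -> (N * N')%type}, induced_on q.
Proof.
move=> [ps pE pT] [ps' pE' pT'].
have qL : linear (fun x : restr (X * X')%type => (p x.1, p' x.2)).
  by move=> a x y; rewrite -[RHS]/(a *: p x.1 + p y.1, a *: p' x.2 + p' y.2)
    -!linearP.
exists (mk_linear qL).
pose f1 : {linear (X * X')%type -> X} := fst.
pose f2 : {linear (X * X')%type -> X'} := snd.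
pose i1 : {linear X -> (X * X')%type} := pairl idfun \0.
pose i2 : {linear X' -> (X * X')%type} := pairl \0 idfun.
split=> [[y y']|[x x']|t t0].
- by have [x <-] := ps y; have [x' <-] := ps' y'; exists (x, x').
- split=> [[/pE[t tE] /pE'[t' tE']]|[t tE]].
    exists (tensor_map M (restr_map i1) t + tensor_map M (restr_map i2) t').
    rewrite linearD -!alpha_map tE tE' -[LHS]/((x + 0, 0 + x') : X * X').
    by rewrite addr0 add0r.
  congr pair.
    by apply/pE; exists (tensor_map M (restr_map f1) t); rewrite -alpha_map tE.
  by apply/pE'; exists (tensor_map M (restr_map f2) t); rewrite -alpha_map tE.
- have t1 : tensor_map M p (tensor_map M (restr_map f1) t) = 0.
    by apply: pT; rewrite -alpha_map t0.
  have t2 : tensor_map M p' (tensor_map M (restr_map f2) t) = 0.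
    by apply: pT'; rewrite -alpha_map t0.
  set u := tensor_map M _ t.
  pose j1 : {linear N -> (N * N')%type} := pairl idfun \0.
  pose j2 : {linear N' -> (N * N')%type} := pairl \0 idfun.
  have -> : u = tensor_map M j1 (tensor_map M fst u) +
                tensor_map M j2 (tensor_map M snd u).
    elim/tensor_ind: u => [|s s' hs hs'|m [y y']];
      first by rewrite !linear0 addr0.
      by rewrite {1}hs {1}hs' !linearB opprD addrACA.
    rewrite !tensor_mapE -tensDr; congr (tens m _).
    by rewrite -[RHS]/(y + 0, 0 + y') addr0 add0r.
  have -> : tensor_map M fst u = 0.
    rewrite /u -(tensor_map_comp (h := p \o restr_map f1))//.
    by rewrite (tensor_map_comp (f := restr_map f1) (g := p)).
  have -> : tensor_map M snd u = 0.
    rewrite /u -(tensor_map_comp (h := p' \o restr_map f2))//.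
    by rewrite (tensor_map_comp (f := restr_map f2) (g := p')).
  by rewrite !linear0 addr0.
Qed.

Lemma classBP (C : modclass R) X : is_class C ->
  classB M C X <-> exists N (p : {linear restr X -> N}), C N /\ induced_on p.
Proof.
move=> [C0 CI]; split=> [[CN ae]|[N [p [CN ip]]]].
  exists (coker (alpha X)), (coker_proj (alpha X)); split=> //.
  split=> [||t]; [exact: coker_proj_surj | by move=> x;
    exact: coker_proj_eq0 |].
  move=> /ae[s <-]; rewrite -(tensor_map_comp (h := coker_proj _ \o alpha X))//.
  by apply: tensor_map_eq0 => x; apply/coker_proj_eq0; exists x.
have [ps pE pT] := ip; split; last first.
  move=> t; split=> [/pT|[s <-]]; last exact: alpha_alpha.
  exact: induced_on_alpha0.
have [|f fE] := @factor_through_surj _ _ _ _ p (coker_proj (alpha X)) ps.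
  by move=> x /pE/coker_proj_eq0.
apply: CI CN; exists f; apply: inj_surj_bij.
  apply: linear_inj => y; have [x <-] := ps y.
  by rewrite fE => /coker_proj_eq0/pE.
by move=> c; have [x <-] := coker_proj_surj c; exists (p x).
Qed.

Lemma alpha_ind N t : alpha (ind M N)
  t = ind_in2 M N (tensor_map M (ind_pr1 M N) t).
Proof.
elim/tensor_ind: t => [|s t hs ht|m x]; first by rewrite !linear0.
  by rewrite !linearB hs ht.
by rewrite tensor_mapE alphaE ind_mact.
Qed.

Lemma ind_induced N : induced_on (ind_pr1 M N).
Proof.
split=> [x|y|t]; first by exists (ind_in1 M N x).
- split=> [y0|[t <-]]; last by rewrite alpha_ind ind_pr1_in2.
  exists (tensor_map M (ind_in1 M N) (ind_pr2 M N y)).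
  by rewrite alpha_in1 [RHS]ind_decomp y0 linear0 add0r.
- by rewrite alpha_ind => /(congr1 (ind_pr2 M N)); rewrite ind_pr2_in2 linear0.
Qed.

Lemma classB_ind (C : modclass R) N : is_class C -> C N -> classB M C (ind M N).
Proof.
move=> Cc CN; apply/classBP => //; exists N, (ind_pr1 M N).
by split=> //; exact: ind_induced.
Qed.

Lemma classB_is_class (C : modclass R) : is_class C -> is_class (classB M C).
Proof.
move=> Cc; have [C0 _] := Cc; split=> [X X0|X Y XY].
  apply/classBP => //; exists (zero_obj R), \0; split; first exact/C0/zero_objP.
  split=> [y|x|t _]; first by exists 0; rewrite (zero_objP y).
    by split=> // _; exists 0; rewrite linear0 (X0 x).
  exact: tensor_map_eq0.
move=> /(classBP _ Cc)[N [p [CN ip]]]; have [f fb] := isomorphic_sym XY.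
by apply/classBP => //; exists N, (p \o restr_map f); split=> //;
  exact: induced_on_iso.
Qed.

(** [X] is an extension of [N] by M (x) [N] as an [R]-module. It splits, and a
    section [N -> X] induces the isomorphism with the induced module. *)
Lemma induced_on_ind X N (p : {linear restr X -> N}) :
  induced_on p -> Ext_vanishes 1 N (tensor M N) -> isomorphic (ind M N) X.
Proof.
move=> ip vN; have [ps pE pT] := ip.
have Tps := tensor_map_surj (M := M) ps.
have [|a aE] := @factor_through_surj _ _ _ _ (tensor_map M p) (alpha X) Tps.
  by move=> t /(induced_on_alpha0 ip)[s <-]; exact: alpha_alpha.
have ap : short_exact a p.
  split=> // [|x]; last first.
    rewrite pE; split=> [[t <-]|[u <-]]; first by exists (tensor_map M p t).
    by have [t <-] := Tps u; exists t; rewrite aE.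
  by apply: linear_inj => u; have [t <-] := Tps u; rewrite aE; exact: pT.
have [s sE] := Ext1_split vN ap; have [ai apE _] := ap.
have alphas u : alpha X (tensor_map M s u) = a u.
  by rewrite -aE -(tensor_map_comp (h := p \o s))// tensor_map_id.
exists (ind_lift s); apply: inj_surj_bij.
  apply: linear_inj => y; rewrite ind_liftE alphas => y0.
  have y1 : ind_pr1 M N y = 0.
    have := congr1 p y0.
    by rewrite [in LHS]linearD sE (ses_gf _ ap) addr0 => ->; exact: (linear0 p).
  apply: ind_eq; first by rewrite y1 (linear0 (ind_pr1 M N)).
  rewrite (linear0 (ind_pr2 M N)); apply: (linear_inj0 ai).
  by move: y0; rewrite y1 (linear0 s) add0r.
move=> x; have /apE[u uE] : p ((x : restr X) - s (p x)) = 0.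
  by rewrite linearB sE subrr.
exists (ind_in1 M N (p x) + ind_in2 M N u : ind M N).
rewrite ind_liftE ind_pr1D ind_pr2D alphas uE addrC.
exact: (subrK (s (p x)) (x : restr X)).
Qed.

(** S-linear maps from the induced module are R-linear maps from [N]. Induction
    keeps the sequence of a projective cover of [N]
      exact, as Tor_1(M, N) = 0, and
    its middle term stays projective; this shifts the degree. *)
Lemma acyclic_ind i N Y :
  (forall j, (j < i)%N -> Tor_vanishes j.+1 M N) ->
  acyclic (@extends R (restr Y)) i N -> acyclic (@extends S Y) i (ind M N).
Proof.
elim: i N => [|i IH] N vM hN.
  move=> K X k p kp g; have [ki kpE ps] := kp.
  have [W [p1 [p2 pb]]] := pullback_exists (restr_map p) (ind_in1 M N).
  have [k' kW kE] := pullback_ses pb (restr_ses kp).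
  have [h hE] := hN _ _ _ _ kW (restr_map g); have [c e _] := pb.
  have [ki' kWE p2s] := kW.
  (* X is generated by the preimage W of the copy of N in ind N *)
  have [|y y0|h' h'E] := @factor_through_surj _ _ _ _ (ind_lift p1)
    (ind_lift h).
  - move=> x; pose t := ind_pr2 M N (p x).
    have [s sE] := tensor_map_surj (M := M) p2s t.
    pose x' := (x : restr X) - alpha X (tensor_map M p1 s).
    have [|w w1 _] := e x' (ind_pr1 M N (p x)).
      rewrite /x' linearB restr_mapE [p x in LHS]ind_decomp restr_mapE.
      rewrite alpha_map -(tensor_map_comp (h := ind_in1 M N \o p2))//.
      rewrite (tensor_map_comp (f := p2) (g := ind_in1 M N))// sE alpha_in1.
      exact: addrK.
    exists (ind_in1 M W w + ind_in2 M W s : ind M W).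
    rewrite ind_liftE ind_pr1D ind_pr2D w1 /x'.
    exact: (subrK (alpha X (tensor_map M p1 s)) (x : restr X)).
  - have := congr1 p y0; rewrite ind_liftE (linear0 p) => py0.
    have {}py0 : ind_in1 M N (p2 (ind_pr1 M W y)) +
        ind_in2 M N (tensor_map M p2 (ind_pr2 M W y)) = 0.
      rewrite -alpha_in1 -c -(tensor_map_comp (h := restr_map p \o p1))//.
      rewrite (tensor_map_comp (f := p1) (g := restr_map p))// -alpha_map.
      by rewrite -!restr_mapE -linearD.
    have /kWE[w wE] : p2 (ind_pr1 M W y) = 0.
      by rewrite -[LHS](ind_pr1D _ (tensor_map M p2 (ind_pr2 M W y)))
        py0 linear0.
    have /(tensor_map_exact kWE p2s)[s sE] :
        tensor_map M p2 (ind_pr2 M W y) = 0.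
      by rewrite -[LHS](ind_pr2D (p2 (ind_pr1 M W y))) py0 linear0.
    have hk' : tensor_map M h (ind_pr2 M W y) = tensor_map M (restr_map g) s.
      by rewrite -sE -(tensor_map_comp (h := restr_map g)).
    have p1k' : tensor_map M p1 (ind_pr2 M W y) = tensor_map M (restr_map k) s.
      by rewrite -sE -(tensor_map_comp (h := restr_map k)).
    have kw0 : (w : K) + alpha K s = 0.
      apply: (linear_inj0 ki);
        rewrite linearD alpha_map -p1k' -[RHS]y0 ind_liftE.
      by rewrite -wE kE.
    rewrite ind_liftE hk' -wE hE -alpha_map restr_mapE.
    by rewrite -[LHS](linearD g) kw0; exact: (linear0 g).
  exists h' => u; rewrite -[k u]/(restr_map k u) -kE -(ind_lift_in1 p1).
  by rewrite -[LHS]/(h' (ind_lift p1 _)) h'E ind_lift_in1 hE.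
have [Q [L [l [q [Qp lq]]]]] := projective_cover_ses N.
have v1 : Tor_vanishes 1 M N by exact: vM.
apply: (acyclic_quot (extends_stable Y) (ind_ses v1 lq)); last first.
  by apply: acyclic_projective; [exact: extends_stable|exact: ind_projective].
apply: IH => [j ji|]; last exact: hN Qp lq.
have /Tor_acyclic vj := vM j.+1 ji; apply/Tor_acyclic.
exact: vj Qp lq.
Qed.

(** ** Finite coresolutions by induced modules *)

Variables (C : modclass R) (n : nat).
Hypotheses (n1 : (1 <= n)%N) (Cc : is_class C).
Hypothesis vM : forall i (B : lmodType R), (1 <= i <= n)%N -> C B ->
  Tor_vanishes i M B.

Lemma vee_len_ind k E : (k < n)%N ->
  vee_len C k E -> vee_len (classB M C) k (ind M E).
Proof.
elim: k E => [|k IH] E kn; first exact: classB_ind.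
move=> [B [K [f [g [fg CB wK]]]]].
exists (ind M B), (ind M K), (ind_map M f), (ind_map M g); split.
- by apply: ind_ses => //; apply: (Tor_vee_len vM wK) => //; exact: ltnW.
- exact: classB_ind.
- by apply: IH => //; exact: ltnW.
Qed.

(** The proof is the nine lemma for the first step of the coresolution,
    [X -> B0 -> X'], and the extensions of the quotient by the image of [M] by
    M (x) that quotient; the column M (x) _ is exact as Tor_1(M, N') = 0. *)
Lemma vee_len_classB k X : (k < n)%N -> vee_len (classB M C) k X ->
  exists N (p : {linear restr X -> N}), vee_len C k N /\ induced_on p.
Proof.
elim: k X => [|k IH] X kn; first by move/(classBP _ Cc).
move=> [B0 [X' [f [g [fg /(classBP _ Cc)[N0 [p0 [CN0 ip0]]]]]]]].
move=> /IH[|N' [p' [wN' ip']]]; first exact: ltnW.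
have [ps' pE' pT'] := ip'; have [ps0 pE0 pT0] := ip0; have [fi fgE gs] := fg.
have [|v vE] := @factor_through_surj _ _ _ _ p0 (p' \o restr_map g) ps0.
  by move=> x /pE0[t <-]; rewrite /= restr_mapE alpha_map;
    exact: induced_on_alpha.
have vs : surj v.
  move=> y; have [x' <-] := ps' y; have [b <-] := gs x'.
  by exists (p0 b); rewrite vE.
have kv := ker_ses vs; set ka : {linear ker v -> N0} := \val in kv.
have [kai kaE _] := kv.
have [|p pE] := @lift_through_inj _ _ _ _ ka (p0 \o restr_map f) kai.
  by move=> x; apply/kaE; rewrite /= vE /= !restr_mapE (ses_gf _ fg) linear0.
have pfE x : ka (p x) = p0 (f x) by exact: pE.
have v1 : Tor_vanishes 1 M N' by apply: (Tor_vee_len vM wN') => //; exact: ltnW.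
have [Tki TkE _] := tensor_ses v1 kv.
have Tgs := tensor_map_surj (M := M) (f := restr_map g) gs.
have ps : surj p.
  move=> z; have [b bE] := ps0 (ka z).
  have /pE'[t' tE'] : p' (g b) = 0.
    by rewrite -[LHS]vE bE; apply/kaE; exists z.
  have [t tE] := Tgs t'.
  have /fgE[x xE] : g (b - alpha B0 t) = 0.
    rewrite -[LHS]/(restr_map g _) linearB !restr_mapE alpha_map tE tE'.
    exact: subrr.
  exists x; apply: kai; rewrite pfE xE linearB (induced_on_alpha _ ip0) bE.
  exact: subr0.
have Tp t : tensor_map M ka (tensor_map M p t) =
    tensor_map M p0 (tensor_map M (restr_map f) t).
  by rewrite -!(tensor_map_comp (h := p0 \o restr_map f)).
have Tv t : tensor_map M v (tensor_map M p0 t) =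
    tensor_map M p' (tensor_map M (restr_map g) t).
  by rewrite -!(tensor_map_comp (h := p' \o restr_map g)).
exists (ker v), p; split; first by exists N0, N', ka, v.
split=> // [x|t t0].
- split=> [px0|[t <-]]; last first.
    by apply: kai; rewrite pfE alpha_map (induced_on_alpha _ ip0) linear0.
  have /pE0[t tE] : p0 (f x) = 0 by rewrite -pfE px0 linear0.
  have /TkE[s sE] : tensor_map M v (tensor_map M p0 t) = 0.
    rewrite Tv; apply: pT'; rewrite -alpha_map tE; exact: (ses_gf _ fg).
  have [t1 t1E] := tensor_map_surj (M := M) ps s.
  have [r rE] : exists r, tensor_map M (alpha B0) r =
      t - tensor_map M (restr_map f) t1.
    apply: (induced_on_alpha0 ip0).
    by rewrite linearB -Tp t1E sE subrr.
  exists t1; apply: fi; rewrite alpha_map -tE.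
  by apply/esym/eqP; rewrite -subr_eq0 -linearB -rE alpha_alpha.
- apply: Tki; rewrite Tp linear0; apply: pT0.
  by rewrite -alpha_map t0; exact: (linear0 f).
Qed.

Hypothesis Bext : closed_under_extensions (vee (classB M C) n.-1).

(** The closure under extensions, assumed over S, gives a coresolution of the
    direct sum of two induced modules; it descends to the quotients by the
    image of M. *)
Lemma vee_len_prod E E' : vee_len C n.-1 E -> vee_len C n.-1 E' ->
  vee_len C n.-1 (E * E')%type.
Proof.
move=> wE wE'; have Bc := classB_is_class Cc.
have kn : (n.-1 < n)%N by rewrite prednK.
have wB A : vee_len C n.-1 A -> vee (classB M C) n.-1 (ind M A).
  by move=> wA; apply/veeP => //; exact: vee_len_ind.
have := Bext (prod_ses (ind M E) (ind M E')) (wB E wE) (wB E' wE').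
move=> /(veeP _ _ Bc)/(vee_len_classB kn)[N [p [wN ip]]].
apply: vee_len_iso wN => //.
have [q iq] := induced_on_prod (ind_induced E) (ind_induced E').
exact: induced_on_unique ip iq.
Qed.

(** Ext^1(E, M (x) E') = 0 for all E and E' with a finite coresolution by C:
    apply the hypothesis to the direct sum of E and E', which again has one. *)
Hypothesis HE : forall E, vee_len C n.-1 E -> Ext_vanishes 1 E (tensor M E).

Lemma Ext_tensor_vee E E' : vee_len C n.-1 E -> vee_len C n.-1 E' ->
  Ext_vanishes 1 E (tensor M E').
Proof.
move=> wE wE'; have vEE := HE (vee_len_prod wE wE').
pose i1 : {linear E -> (E * E')%type} := pairl idfun \0.
pose i2 : {linear E' -> (E * E')%type} := pairl \0 idfun.
apply: (Ext_covariant_retract (s := tensor_map M i2) (r := tensor_map M snd)).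
  by move=> t; rewrite -(tensor_map_comp (h := idfun))// tensor_map_id.
exact: (Ext_retract (s := i1) (r := fst)) vEE.
Qed.

Variable D : modclass R.
Hypotheses (CD : right_cotorsion_pair n C D) (her : hereditary n C D).

(** The approximation M (x) E -> A -> K splits. *)
Lemma tensor_vee E : vee_len C n.-1 E -> D (tensor M E).
Proof.
move=> wE; have [_ Dc Dsum _ app] := CD.
have [A [K [f [g [fg DA]]]]] := app (tensor M E) => /(veeP _ _ Cc) wK.
have [s sE] := Ext1_split (Ext_tensor_vee wK wE) fg.
exact: summand_sub Dc Dsum fg sE DA.
Qed.

Lemma right_extension_closed (A B B' : lmodType R) (f : {linear A -> B})
    (g : {linear B -> B'}) : short_exact f g -> D A -> D B' -> D B.
Proof.
have [_ _ _ vCD _] := CD; move=> fg DA DB'.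
apply: (right_cotorsion_orthogonal n1 CD) => -[//|i] N iN CN.
by apply: (Ext_covariant_extension fg); exact: vCD.
Qed.

(** [X] is induced from some [N] in C, so that Ext over S from [X] to [Y] is
    controlled by Ext over R from [N] to [Y]. *)
Lemma Ext_classB_classU i X Y : (i <= n)%N -> classB M C X -> classU M D Y ->
  Ext_vanishes i.+1 X Y.
Proof.
have [_ _ _ vCD _] := CD; move=> ilen /(classBP _ Cc)[N [p [CN ip]]] DY.
have wN : vee_len C n.-1 N.
  by elim: n.-1 => // k; exact: vee_lenS.
apply/Ext_acyclic; apply: (acyclic_iso (induced_on_ind ip (HE wN))).
apply: acyclic_ind => [k ki|].
  by apply: vM => //=; apply: leq_trans ki _.
apply/Ext_acyclic; have [iltn|nlei] := ltnP i n; first exact: vCD.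
have -> : i = n by apply/eqP; rewrite eqn_leq ilen.
exact: her.
Qed.

(** Push the induced approximation S (x) A -> S (x) D0 out along the counit
    S (x) A -> A: the cokernel is induced, and over R the pushout is an
    extension of M (x) K by D0. *)
Lemma right_approximation (A : lmodType S) :
  exists (X K : lmodType S) (f : {linear A -> X}) (g : {linear X -> K}),
    [/\ short_exact f g, classU M D X & vee (classB M C) n.-1 K].
Proof.
have kn : (n.-1 < n)%N by rewrite prednK.
have [_ _ _ _ app] := CD.
have [D0 [K [i [q [iq DD0 /(veeP _ _ Cc) wK]]]]] := app (restr A).
have [ii iqE qs] := iq.
have vK : Tor_vanishes 1 M K by apply: (Tor_vee_len vM wK); rewrite // add1n.
have [Ti _ _] := tensor_ses vK iq; have ciq := ind_ses vK iq.
pose eps : {linear ind M (restr A) -> A} :=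
  ind_lift (idfun : {linear restr A -> restr A}).
have [W [j1 [j2 po]]] := pushout_exists (ind_map M i) eps.
have [q' jq qE] := pushout_ses po ciq; have [j2i jqE q's] := jq.
exists W, (ind M K), j2, q'; split=> //; last first.
  by apply/veeP; [exact: classB_is_class | exact: vee_len_ind].
pose incl : {linear D0 -> restr W} := restr_map j1 \o ind_in1 M D0.
pose pr : {linear restr W -> tensor M K} := ind_pr2 M K \o restr_map q'.
apply: (right_extension_closed (f := incl) (g := pr)) => //;
  last exact: tensor_vee.
have [c e _] := po.
have map_in1 N N' (h : {linear N -> N'}) x :
    ind_map M h (ind_in1 M N x) = ind_in1 M N' (h x).
  by rewrite /ind_map ind_lift_in1.
split=> [|w|t].
- apply: linear_inj => x x0.
  have [|z zE zE'] := e (ind_in1 M D0 x) 0.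
    by rewrite (linear0 j2).
  have z2 : ind_pr2 M _ z = 0.
    by apply: (linear_inj0 Ti); rewrite -ind_pr2_map -zE.
  have z1 : ind_pr1 M _ z = 0.
    move: zE'; rewrite /eps ind_liftE z2 !linear0 addr0.
    exact: esym.
  by have /(congr1 (ind_pr1 M D0)) := zE; rewrite ind_pr1_map z1 linear0.
- split=> [prw0|[x <-]]; last first.
    by rewrite /= !restr_mapE qE map_in1.
  have [x xE] := qs (ind_pr1 M K (q' w)).
  have q'w : q' w = ind_in1 M K (q x).
    by rewrite xE [LHS]ind_decomp -[ind_pr2 M K _]/(pr w) prw0 linear0 addr0.
  have /jqE[a aE] : q' (w - j1 (ind_in1 M D0 x)) = 0.
    by rewrite linearB qE map_in1 q'w subrr.
  exists (x + i a); rewrite linearD.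
  have -> : incl (i a) = j2 a.
    rewrite -[incl _]/(j1 _) -map_in1 c; congr (j2 _).
    by rewrite /eps ind_lift_in1.
  by rewrite aE addrC; exact: (subrK (incl x) (w : restr W)).
- by have [w wE] := q's (ind_in2 M K t); exists w; rewrite /= restr_mapE wE.
Qed.

End Induced.

Theorem proposition4p9 (R : pzRingType) (M : bimodType R) (n : nat)
    (C D : modclass R) :
  (1 <= n)%N ->
  (left_cotorsion_pair n C D /\ hereditary n C D ->
   (forall i X, (1 <= i <= n)%N -> D X -> Ext_vanishes i M X) ->
   (forall F, wedge D n.-1 F -> Ext_vanishes 1 (homM M F) F) ->
   closed_under_extensions (wedge (classJ M D) n.-1) ->
   left_cotorsion_pair n (classU M C) (classJ M D) /\
   hereditary n (classU M C) (classJ M D)) /\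
  (right_cotorsion_pair n C D /\ hereditary n C D ->
   (forall i X, (1 <= i <= n)%N -> C X -> Tor_vanishes i M X) ->
   (forall E, vee C n.-1 E -> Ext_vanishes 1 E (tensor M E)) ->
   closed_under_extensions (vee (classB M C) n.-1) ->
   right_cotorsion_pair n (classB M C) (classU M D) /\
   hereditary n (classB M C) (classU M D)).
Proof.
move=> n1; split=> -[CD her] vM.
- move=> HF Jext; have [Cc Dc Csum _ _] := CD.
  have HF' F : wedge_len D n.-1 F -> Ext_vanishes 1 (homM M F) F.
    by move=> wF; apply: HF; exact/wedgeP.
  have vUJ := Ext_classU_classJ Dc vM HF' CD her.
  split=> [|X Y]; last exact: vUJ.
  split; [exact: classU_is_class | exact: classJ_is_class |
          exact: classU_summands | | exact: left_approximation].
  by move=> [//|i] X Y /= iltn; apply: vUJ; exact: ltnW.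
- move=> HE Bext; have [Cc Dc Dsum _ _] := CD.
  have HE' E : vee_len C n.-1 E -> Ext_vanishes 1 E (tensor M E).
    by move=> wE; apply: HE; exact/veeP.
  have vBU := Ext_classB_classU Cc vM HE' CD her.
  split=> [|X Y]; last exact: vBU.
  split; [exact: classB_is_class | exact: classU_is_class |
          exact: classU_summands | | exact: right_approximation].
  by move=> [//|i] X Y /= iltn; apply: vBU; exact: ltnW.
Qed.
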